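(* Let $T>0$, let $\mathcal L$ be an unbounded closed operator on $L^2(\mathbb R^d)$ with dense domain $D\subseteq L^2(\mathbb R^d)$ which generates a $C_0$-semigroup on $L^2(\mathbb R^d)$. Let $F\in C([0,T];L^2(\mathbb R^d))\otimes (S)_{-1}$ be a generalized stochastic process with chaos expansion $F=\sum_{\gamma\in\mathcal I}f_\gamma H_\gamma$ whose coefficients $f_\gamma\in C([0,T];L^2(\mathbb R^d))$ are Lipschitz continuous with respect to $t$ for every $\gamma\in\mathcal I$, and let $G\in D\otimes (S)_{-1}$. Let $q\in L^\infty(\mathbb R^d)\cap C(\mathbb R^d)$, and consider the stochastic parabolic problem $$\Big(\frac{\partial}{\partial t}-\mathcal L\Big)U(t,x,\omega)+q(x)\cdot U(t,x,\omega)=F(t,x,\omega),\qquad U(0,x,\omega)=G(x,\omega),$$ $t\in(0,T]$, $x\in\mathbb R^d$, $\omega\in\Omega$. Let $X=C([0,T];L^2(\mathbb R^d))$, let $V\in X\otimes(S)_{-1}$ be the (unique) solution of this problem in $C([0,T];D)\otimes(S)_{-1}$, and let $(U_\varepsilon)_{\varepsilon\in(0,1]}\subset X\otimes(S)_{-1}$ be the very weak solution to this problem corresponding to a regularizing net $q_\varepsilon=q*\varphi_\varepsilon$, $\varepsilon\in(0,1]$. Then, for some $s>1$, $$\|U_\varepsilon-V\|_{X\otimes(S)_{-s}}\to0\qquad\text{as }\varepsilon\to0.$$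
   Context: Chaos expansions. $(\Omega,\mathcal F,\mathbb P)$ is the Gaussian white noise space. $\mathcal I$ is the set of sequences $\gamma=(\gamma_1,\gamma_2,\dots)$ of non-negative integers with only finitely many nonzero entries. For $\gamma\in\mathcal I$, $H_\gamma(\omega)=\prod_{k\ge1}h_{\gamma_k}(\langle\omega,\xi_k\rangle)$ is the Fourier–Hermite polynomial ($h_k$ Hermite polynomials, $\xi_k$ Hermite functions), and $(2\mathbb N)^{\gamma}=\prod_{i\ge1}(2i)^{\gamma_i}$. For a normed space $Y$ and $p\ge0$, $Y\otimes (S)_{-p}$ is the space of formal expansions $F=\sum_{\gamma\in\mathcal I}f_\gamma H_\gamma$ with $f_\gamma\in Y$ and $\|F\|^2_{Y\otimes (S)_{-p}}=\sum_{\gamma\in\mathcal I}\|f_\gamma\|_Y^2(2\mathbb N)^{-p\gamma}<\infty$; $Y\otimes (S)_{-1}$ denotes the union (inductive limit) of the spaces $Y\otimes (S)_{-p}$ over $p\ge0$. $X=C([0,T];L^2(\mathbb R^d))$ has norm $\sup_{t\in[0,T]}\|f(t,\cdot)\|_{L^2(\mathbb R^d)}$; $D$ and $C([0,T];D)$ are taken with the norms of $L^2(\mathbb R^d)$ and $X$. Solutions. $\mathcal L$ acts coefficientwise in the space variable, $\mathcal LU=\sum_\gamma(\mathcal Lu_\gamma)H_\gamma$, and so does multiplication by a bounded potential. For a bounded potential $r$, $U=\sum_\gamma u_\gamma H_\gamma\in C([0,T];D)\otimes(S)_{-1}$ is a solution of $(\partial_t-\mathcal L)U+rU=F$, $U(0)=G$,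 if for each $\gamma\in\mathcal I$, $u_\gamma$ solves $(\partial_t-\mathcal L)u_\gamma+ru_\gamma=f_\gamma$, $u_\gamma(0,\cdot)=g_\gamma$ in the semigroup (strong) sense: $u_\gamma\in C([0,T];D)$ is absolutely continuous and differentiable a.e. as an $L^2(\mathbb R^d)$-valued function with $u_\gamma'\in L^1(0,T;L^2(\mathbb R^d))$, and satisfies the equation for a.e. $t$ and the initial condition. Regularization. A mollifier is $\varphi\in C_0^\infty(\mathbb R^d)$ with $\varphi\ge0$, $\int\varphi=1$; a mollifying net is $\varphi_\varepsilon(x)=l(\varepsilon)^{-d}\varphi(x/l(\varepsilon))$, $\varepsilon\in(0,1]$, with $l>0$ and $l(\varepsilon)\to0$ as $\varepsilon\to0$; $q_\varepsilon=q*\varphi_\varepsilon$ is the corresponding regularizing net of $q$. Moderateness. A net $U_\varepsilon\in X\otimes(S)_{-p_\varepsilon}$, $\varepsilon\in(0,1]$, $p_\varepsilon\ge0$, for which $p=\sup_\varepsilon p_\varepsilon$ exists, is $X\otimes(S)_{-p}$-moderate if there exist $N\in\mathbb N_0$ and $C>0$ such that $\|U_\varepsilon\|_{X\otimes(S)_{-p}}\le C\varepsilon^{-N}$ for each $\varepsilon\in(0,1]$; it is assumed that $p>1$. Stochastic very weak solution. A net $(U_\varepsilon)_{\varepsilon\in(0,1]}$ of stochastic processes in $X\otimes(S)_{-1}$ is a very weak solution corresponding to the regularizing net $(q_\varepsilon)_{\varepsilon\in(0,1]}$ (which is $L^\infty(\mathbb R^d)$-moderate, i.e. $\|q_\varepsilon\|_{L^\infty}\le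 C\varepsilon^{-N}$ for some $C>0$, $N\in\mathbb N_0$) if for every $\varepsilon\in(0,1]$ the process $U_\varepsilon$ is a solution to $(\partial_t-\mathcal L)U+q_\varepsilon U=F$, $U(0)=G$, and $(U_\varepsilon)_{\varepsilon\in(0,1]}$ is a moderate net of stochastic processes. *)

(* Defs.v *)
From HB Require Import structures.
From mathcomp Require Import all_boot all_order all_algebra finmap.
From mathcomp Require Import all_classical all_reals all_analysis.
From mathcomp Require Import measurable_realfun ess_sup_inf.
Set Implicit Arguments.
Unset Strict Implicit.
Unset Printing Implicit Defensive.
Import Order.TTheory GRing.Theory Num.Theory.
Import numFieldNormedType.Exports.
Local Open Scope classical_set_scope.
Local Open Scope ring_scope.
Local Open Scope quotient_scope.

(* The library's [LspaceType mu p1], a quotient by a.e. equality, carries no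
   algebraic structure; it is made here into a normed module. *)
Section Lspace_normed.
Context d (T : measurableType d) (R : realType).
Variables (mu : {measure set T -> \bar R}) (p : \bar R) (p1 : (1 <= p)%E).
Local Notation Lf := (LfunType mu p1).
Local Notation Ls := (LspaceType mu p1).
Local Notation Q := {mfun_ mu, T >-> measurableTypeR R}.

Definition Lrepr (f : Ls) : T -> R := repr (f : Q).

Lemma Lrepr_meas (f : Ls) : measurable_fun setT (Lrepr f).
Proof. exact: (@measurable_funPT _ _ _ _ (repr (f : Q))). Qed.

Lemma Lrepr_Lfun (f : Ls) : Lrepr f \in Lfun mu p.
Proof.
rewrite inE; apply/andP; split; rewrite inE /=.
  exact: Lrepr_meas.
exact: (Lebesgue_finite (s := f)).
Qed.

Lemma ae_eq_Lnorm (f g : T -> R) : measurable_fun setT f ->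
  measurable_fun setT g -> f = g %[ae mu] ->
  ('N[mu]_p[EFin \o f] = 'N[mu]_p[EFin \o g])%E.
Proof.
move=> mf mg fg; rewrite unlock /Lnorm; case: p => [r| |] /=.
- congr (_ `^ _)%E; apply: ge0_ae_eq_integral => //.
  + apply/measurable_EFinP.
    apply: (@measurableT_comp _ _ _ _ _ _ (@powR R ^~ r)) => //.
    exact: measurableT_comp.
  + apply/measurable_EFinP.
    apply: (@measurableT_comp _ _ _ _ _ _ (@powR R ^~ r)) => //.
    exact: measurableT_comp.
  + by apply: filterS fg => x /(_ I) /= ->.
- case: ifPn => // _; apply: eq_ess_sup.
  by apply: filterS fg => x /(_ I) /= ->.
- case: ifPn => // _; apply: eq_ess_inf.
  by apply: filterS fg => x /(_ I) /= ->.
Qed.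

Section class.
Variables (f : T -> R) (fL : f \in Lfun mu p).

Let fm : measurable_fun setT f.
Proof. by move: fL; rewrite inE => /andP[]; rewrite inE. Qed.
Let ffin : finite_norm mu p f.
Proof. by move: fL; rewrite inE => /andP[_]; rewrite inE. Qed.

Definition Lmfun : {mfun T >-> measurableTypeR R} :=
  HB.pack (f : T -> measurableTypeR R)
   (@isMeasurableFun.Build _ _ T (measurableTypeR R) f fm).

Lemma repr_Lmfun : (repr (\pi_Q Lmfun) : T -> R) = f %[ae mu].
Proof.
have /eqmodP : repr (\pi_Q Lmfun) = Lmfun %[mod Q] by rewrite reprK.
by move=> /asboolP.
Qed.

Lemma finite_norm_pi : finite_norm mu p (\pi_Q Lmfun : Q).
Proof.
rewrite /finite_norm.
have h := repr_Lmfun.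
rewrite (@ae_eq_Lnorm _ f) //.
exact: (@measurable_funPT _ _ _ _ (repr (\pi_Q Lmfun))).
Qed.

Definition Lclass : Ls :=
  HB.pack (\pi_Q Lmfun) (isFinLebesgue.Build _ T R mu p p1 (\pi_Q Lmfun) finite_norm_pi).

Lemma LreprE : Lrepr Lclass = f %[ae mu].
Proof. exact: repr_Lmfun. Qed.
End class.

Lemma Lspace_ext (f g : Ls) : Lrepr f = Lrepr g %[ae mu] -> f = g.
Proof.
move=> fg.
have fgQ : (f : Q) = (g : Q).
  rewrite -[LHS]reprK -[RHS]reprK; apply/eqmodP/asboolP; exact: fg.
case: f g fgQ {fg} => f [[hf]] [g [[hg]]] /= fg.
move: fg hf hg => -> hf hg.
by rewrite (Prop_irrelevance hf hg).
Qed.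


HB.instance Definition _ := gen_eqMixin Ls.
HB.instance Definition _ := gen_choiceMixin Ls.

Lemma LfunD (f g : T -> R) : f \in Lfun mu p -> g \in Lfun mu p ->
  f \+ g \in Lfun mu p.
Proof. by move=> fL gL; case: (Lfun_addr_closed mu p1) => _; apply. Qed.

Lemma LfunN (f : T -> R) : f \in Lfun mu p -> \- f \in Lfun mu p.
Proof. exact: (@Lfun_oppr_closed _ T R mu p). Qed.

Lemma LfunZ (a : R) (f : T -> R) : f \in Lfun mu p -> a \*: f \in Lfun mu p.
Proof.
move=> fL; have [L0 L] := Lfun_submod_closed mu p1.
have := L a f 0 fL L0; rewrite addr0; exact.
Qed.

Lemma Lfun0 : cst 0 \in Lfun mu p.
Proof. by have [L0 _] := Lfun_submod_closed mu p1. Qed.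

Definition Lzero : Ls := Lclass Lfun0.
Definition Ladd (f g : Ls) : Ls := Lclass (LfunD (Lrepr_Lfun f) (Lrepr_Lfun g)).
Definition Lopp (f : Ls) : Ls := Lclass (LfunN (Lrepr_Lfun f)).
Definition Lscale (a : R) (f : Ls) : Ls := Lclass (LfunZ a (Lrepr_Lfun f)).

Let LaddA : associative Ladd.
Proof.
move=> f g h; apply: Lspace_ext.
have := LreprE (LfunD (Lrepr_Lfun f) (Lrepr_Lfun (Ladd g h))).
apply: filter_app.
have := LreprE (LfunD (Lrepr_Lfun (Ladd f g)) (Lrepr_Lfun h)).
apply: filter_app.
have := LreprE (LfunD (Lrepr_Lfun f) (Lrepr_Lfun g)).
have := LreprE (LfunD (Lrepr_Lfun g) (Lrepr_Lfun h)).
apply: filterS2 => x /= H1 H2 H3 H4 _; move: (H1 I) (H2 I) (H3 I) (H4 I).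
by rewrite /Ladd => {}H1 {}H2 -> ->; rewrite H1 H2 addrA.
Qed.

Let LaddC : commutative Ladd.
Proof.
move=> f g; apply: Lspace_ext.
have := LreprE (LfunD (Lrepr_Lfun f) (Lrepr_Lfun g)).
have := LreprE (LfunD (Lrepr_Lfun g) (Lrepr_Lfun f)).
apply: filterS2 => x /= H1 H2 _; move: (H1 I) (H2 I).
by rewrite /Ladd => -> ->; rewrite addrC.
Qed.

Let Ladd0 : left_id Lzero Ladd.
Proof.
move=> f; apply: Lspace_ext.
have := LreprE (LfunD (Lrepr_Lfun Lzero) (Lrepr_Lfun f)).
have := LreprE Lfun0.
apply: filterS2 => x /= H1 H2 _; move: (H1 I) (H2 I).
by rewrite /Ladd /Lzero => {}H1 ->; rewrite H1 add0r.
Qed.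

Let LaddN : left_inverse Lzero Lopp Ladd.
Proof.
move=> f; apply: Lspace_ext.
have := LreprE (LfunD (Lrepr_Lfun (Lopp f)) (Lrepr_Lfun f)).
have := LreprE (LfunN (Lrepr_Lfun f)).
have := LreprE Lfun0.
apply: filterS3 => x /= H1 H2 H3 _; move: (H1 I) (H2 I) (H3 I).
by rewrite /Ladd /Lzero /Lopp => {}H1 {}H2 ->; rewrite H1 H2 addNr.
Qed.

HB.instance Definition _ := GRing.isZmodule.Build Ls LaddA LaddC Ladd0 LaddN.

Lemma LreprD (f g : Ls) : Lrepr (f + g) = Lrepr f \+ Lrepr g %[ae mu].
Proof. exact: LreprE. Qed.

Lemma LreprN (f : Ls) : Lrepr (- f) = \- Lrepr f %[ae mu].
Proof. exact: LreprE. Qed.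

Lemma Lrepr0 : Lrepr 0 = cst 0 %[ae mu].
Proof. exact: LreprE. Qed.

Lemma Lrepr_scale a (f : Ls) : Lrepr (Lscale a f) = a \*: Lrepr f %[ae mu].
Proof. exact: LreprE. Qed.

Let LscaleA a b (f : Ls) : Lscale a (Lscale b f) = Lscale (a * b) f.
Proof.
apply: Lspace_ext; have := Lrepr_scale b f; have := Lrepr_scale (a * b) f.
have := Lrepr_scale a (Lscale b f).
apply: filterS3 => x /= H1 H2 H3 _; move: (H1 I) (H2 I) (H3 I).
by move=> -> -> /= ->; rewrite /GRing.scale/= mulrA.
Qed.

Let Lscale1 : left_id 1 Lscale.
Proof.
move=> f; apply: Lspace_ext; have := Lrepr_scale 1 f.
by apply: filterS => x /= H1 _; rewrite (H1 I) scale1r.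
Qed.

Let LscaleDr : right_distributive Lscale +%R.
Proof.
move=> a f g; apply: Lspace_ext.
have := LreprD (Lscale a f) (Lscale a g); apply: filter_app.
have := Lrepr_scale a (f + g); apply: filter_app.
have := LreprD f g.
have := Lrepr_scale a f; have := Lrepr_scale a g.
apply: filterS3 => x /= H1 H2 H3 H4 H5 _.
by rewrite (H5 I) (H4 I) (H3 I) (H2 I) (H1 I) scalerDr.
Qed.

Let LscaleDl (f : Ls) : {morph Lscale^~ f : a b / a + b}.
Proof.
move=> a b; apply: Lspace_ext.
have := LreprD (Lscale a f) (Lscale b f); apply: filter_app.
have := Lrepr_scale (a + b) f.
have := Lrepr_scale a f; have := Lrepr_scale b f.
apply: filterS3 => x /= H1 H2 H3 H4 _.
by rewrite (H4 I) (H3 I) (H2 I) (H1 I) scalerDl.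
Qed.

HB.instance Definition _ := GRing.Zmodule_isLmodule.Build R Ls
  LscaleA Lscale1 LscaleDr LscaleDl.

Definition Lspace_norm (f : Ls) : R := fine 'N[mu]_p[EFin \o Lrepr f]%E.

Let norm_sub (f : Ls) : Lspace_norm f =
  fine 'N[mu]_p[EFin \o (Lfun_Sub p1 (Lrepr_Lfun f) : Lf)]%E.
Proof. by []. Qed.

Let norm_ae (f : Ls) (g : Lf) : Lrepr f = g %[ae mu] ->
  Lspace_norm f = fine 'N[mu]_p[EFin \o g]%E.
Proof.
by move=> fg; congr fine; apply: ae_eq_Lnorm => //; exact: Lrepr_meas.
Qed.

Let LnormD (f g : Ls) :
  Lspace_norm (f + g) <= Lspace_norm f + Lspace_norm g.
Proof.
rewrite (@norm_ae _ ((Lfun_Sub p1 (Lrepr_Lfun f) : Lf) +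
  (Lfun_Sub p1 (Lrepr_Lfun g) : Lf))); last exact: LreprD.
exact: ler_LnormD.
Qed.

Let LnormZ_ (a : R) (f : Ls) : Lspace_norm (a *: f) = `|a| * Lspace_norm f.
Proof.
apply: EFin_inj.
have -> : Lspace_norm (a *: f) = fine
    'N[mu]_p[EFin \o (a \*: (Lfun_Sub p1 (Lrepr_Lfun f) : Lf))]%E.
  by apply: (@norm_ae _ (a *: (Lfun_Sub p1 (Lrepr_Lfun f) : Lf)));
    exact: Lrepr_scale.
rewrite LnormZ EFinM norm_sub -finite_norm_fine.
by rewrite fineK.
Qed.

Let Lnorm_eq0 (f : Ls) : Lspace_norm f = 0 -> f = 0.
Proof.
rewrite norm_sub => /fine_Lnormr_eq0 f0; apply: Lspace_ext.
have := Lrepr0; move: f0; apply: filterS2 => x /= H1 H2 _.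
by rewrite (H1 I) (H2 I).
Qed.

HB.instance Definition _ := Lmodule_isNormed.Build R Ls LnormD LnormZ_ Lnorm_eq0.

End Lspace_normed.

Lemma Lspace_normE d (T : measurableType d) (R : realType)
  (mu : {measure set T -> \bar R}) (p : \bar R) (p1 : (1 <= p)%E)
  (f : LspaceType mu p1) : `|f| = fine 'N[mu]_p[EFin \o Lrepr f]%E.
Proof. by []. Qed.

(* ['rV[R]_n] gets the product sigma-algebra, generated by the coordinates as
   for the library's tuples; it is the Borel sigma-algebra of R^n. *)
Section Rd_measurable.
Context (R : realType) (n : nat).
Let coord : 'I_n -> 'rV[R]_n -> R := fun i x => x ord0 i.

Let rV_set0 : g_sigma_preimage coord set0.
Proof. exact: sigma_algebra0. Qed.

Let rV_setC A : g_sigma_preimage coord A -> g_sigma_preimage coord (~` A).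
Proof. exact: sigma_algebraC. Qed.

Let rV_bigcup (F : _^nat) : (forall i, g_sigma_preimage coord (F i)) ->
  g_sigma_preimage coord (\bigcup_i (F i)).
Proof. exact: sigma_algebra_bigcup. Qed.

HB.instance Definition _ := @isMeasurable.Build
  (measure_tuple_display default_measure_display)
  'rV[R]_n (g_sigma_preimage coord) rV_set0 rV_setC rV_bigcup.

Lemma measurable_coord (i : 'I_n) :
  measurable_fun [set: 'rV[R]_n] (fun x : 'rV[R]_n => x ord0 i).
Proof.
move=> _ Y mY; rewrite setTI; apply: sub_sigma_algebra => /=.
rewrite -bigcup_seq/=; exists i => /=; first by rewrite mem_index_enum.
by exists Y => //; rewrite setTI.
Qed.

Lemma measurable_fun_coordP d (T : measurableType d) (f : T -> 'rV[R]_n) :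
  (forall i, measurable_fun [set: T] (fun x => f x ord0 i)) ->
  measurable_fun [set: T] f.
Proof.
move=> mf.
suff : g_sigma_preimage (fun i => coord i \o f) `<=` measurable.
  rewrite g_sigma_preimage_comp => prefS _ A mA.
  by apply: prefS; exists A.
apply: smallest_sub; first exact: sigma_algebra_measurable.
case: n f mf @coord => [|k] f mf crd; first by rewrite big_ord0.
rewrite -bigcup_mkord_ord; apply: bigcup_sub => i Ii.
by move=> A [B mB <-]; exact: mf.
Qed.

End Rd_measurable.

Section Lebesgue_Rd.
Context (R : realType).

Definition rV_cons n (z : measurableTypeR R * 'rV[R]_n) : 'rV[R]_n.+1 :=
  @row_mx R 1 1 n z.1%:M z.2.

Definition rV_uncons n (x : 'rV[R]_n.+1) : measurableTypeR R * 'rV[R]_n :=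
  (x ord0 ord0, \row_j x ord0 (lift ord0 j)).

Lemma rV_uncons_head n z : @rV_cons n z ord0 ord0 = z.1.
Proof.
rewrite /rV_cons (_ : @ord0 n = lshift n (@ord0 0)); last exact/val_inj.
by apply: etrans (row_mxEl _ _ _ _) _; rewrite mxE eqxx mulr1n.
Qed.

Lemma rV_uncons_tail n z j : @rV_cons n z ord0 (lift ord0 j) = z.2 ord0 j.
Proof.
rewrite /rV_cons (_ : lift ord0 j = rshift 1 j); last exact/val_inj.
exact: row_mxEr.
Qed.

Lemma rV_consK n : cancel (@rV_cons n) (@rV_uncons n).
Proof.
move=> [x y]; rewrite /rV_uncons rV_uncons_head; congr pair.
by apply/rowP => j; rewrite mxE rV_uncons_tail.
Qed.

Lemma measurable_rV_cons n : measurable_fun [set: _] (@rV_cons n).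
Proof.
apply: measurable_fun_coordP => i.
have [->|[j ->]] : i = ord0 \/ exists j, i = lift ord0 j.
  by case: (unliftP ord0 i) => [j ->|->]; [right; exists j|left].
  rewrite (_ : (fun _ => _) = fst); first exact: measurable_fst.
  by apply/funext => z; rewrite rV_uncons_head.
rewrite (_ : (fun _ => _) = (fun v : 'rV[R]_n => v ord0 j) \o snd).
  by apply: measurableT_comp; [exact: measurable_coord|exact: measurable_snd].
by apply/funext => z; rewrite rV_uncons_tail.
Qed.

Lemma measurable_rV_uncons n : measurable_fun [set: _] (@rV_uncons n).
Proof.
apply/measurable_fun_pairP; split; first exact: measurable_coord.
apply: measurable_fun_coordP => i.
rewrite (_ : (fun _ => _) = (fun v : 'rV[R]_n.+1 => v ord0 (lift ord0 i))).
  exact: measurable_coord.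
by apply/funext => z; rewrite /= mxE.
Qed.

Section step.
Context n (m : {sigma_finite_measure set 'rV[R]_n -> \bar R}).

Definition leb_step : set 'rV[R]_n.+1 -> \bar R :=
  pushforward (@lebesgue_measure R \x m)%E (@rV_cons n).

Let leb_step0 : leb_step set0 = 0%E.
Proof. by rewrite /leb_step /pushforward preimage_set0 measure0. Qed.

Let leb_step_ge0 A : (0 <= leb_step A)%E.
Proof. exact: (measure_ge0 (@lebesgue_measure R \x m)%E). Qed.

Let leb_step_sigma_additive : semi_sigma_additive leb_step.
Proof.
move=> F mF tF mUF.
rewrite /leb_step /pushforward preimage_bigcup.
have mpre A : measurable A -> measurable (@rV_cons n @^-1` A).
  by move=> mA; rewrite -[X in measurable X]setTI; exact: measurable_rV_cons.
apply: (measure_semi_sigma_additive (s := (@lebesgue_measure R \x m)%E)).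
- by move=> k; exact: mpre.
- apply/trivIsetP => /= i j _ _ ij; rewrite -preimage_setI.
  by move/trivIsetP : tF => /(_ _ _ _ _ ij) ->//; rewrite preimage_set0.
- by rewrite -preimage_bigcup; exact: mpre.
Qed.

HB.instance Definition _ := isMeasure.Build _ _ _ leb_step
  leb_step0 leb_step_ge0 leb_step_sigma_additive.

Let leb_step_sigma_finite : sigma_finite setT leb_step.
Proof.
have /sigma_finiteP[F [FT ndF Foo]] := sigma_finiteT (@lebesgue_measure R).
have /sigma_finiteP[G [GT ndG Goo]] := sigma_finiteT m.
exists (fun k => @rV_uncons n @^-1` (F k `*` G k)).
  rewrite -preimage_bigcup (_ : \bigcup_k _ = setT) ?preimage_setT//.
  rewrite -setXTT FT GT predeqE => -[x y]; split.
    by move=> [k _ []/= ? ?]; split; exists k.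
  move=> [/= [k _ Fkx] [l _ Gly]]; exists (maxn k l) => //; split.
  - by move: x Fkx; exact/subsetPset/ndF/leq_maxl.
  - by move: y Gly; exact/subsetPset/ndG/leq_maxr.
move=> k; have [mF Fk] := Foo k; have [mG Gk] := Goo k; split.
  rewrite -[X in measurable X]setTI.
  by apply: measurable_rV_uncons => //; exact: measurableX.
rewrite /leb_step /pushforward -comp_preimage.
rewrite (_ : _ \o _ = id); last by apply/funext => z /=; rewrite rV_consK.
by rewrite preimage_id product_measure1E// lte_mul_pinfty// ge0_fin_numE.
Qed.

HB.instance Definition _ := Measure_isSigmaFinite.Build _ _ _ leb_step
  leb_step_sigma_finite.
End step.

(* Lebesgue measure on R^n, as the n-fold product of the one on R. *)
Fixpoint lebesgue_rV n : {sigma_finite_measure set 'rV[R]_n -> \bar R} :=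
  match n with
  | 0 => \d_(0 : 'rV[R]_0)
  | n'.+1 => leb_step (lebesgue_rV n')
  end.

End Lebesgue_Rd.

Lemma lebesgue_rVSE (R : realType) n (A : set (measurableTypeR R))
    (B : set 'rV[R]_n) : measurable A -> measurable B ->
  lebesgue_rV R n.+1
    [set x | A (x ord0 ord0) /\ B (\row_j x ord0 (lift ord0 j))] =
  (lebesgue_measure A * lebesgue_rV R n B)%E.
Proof.
move=> mA mB; rewrite -product_measure1E//=.
rewrite /leb_step /pushforward; congr ((_ \x _)%E _).
by apply/seteqP; split => z /=; rewrite -/((rV_uncons _).2);
   have /= := rV_consK z; case: z => a b [-> ->].
Qed.

Definition L2 (R : realType) (d : nat) := LspaceType2 (lebesgue_rV R d).

Section multiplication.
Context d (X : measurableType d) (R : realType).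
Context (mu : {measure set X -> \bar R}) (p : \bar R) (p1 : (1 <= p)%E).

(* When [r] is essentially bounded and measurable, [r \* Lrepr u] is always in
   L^p, so the default value [0] is not reached. *)
Definition Lmul (r : X -> R) (u : LspaceType mu p1) : LspaceType mu p1 :=
  if pselect (r \* Lrepr u \in Lfun mu p) is left ruL then Lclass p1 ruL else 0.

End multiplication.

Section evolution.
Context (R : realType) (E : normedModType R).
Implicit Types (D : set E) (A : E -> E) (u v f : R -> E) (T : R).

(* An operator with domain [D] is given by a total function [A], whose values
   outside of [D] are irrelevant. *)
Record densely_defined_closed D A : Prop := DenselyDefinedClosed {
  domain0 : D 0 ;
  domain_linear : forall (a : R) x y, D x -> D y ->
    D (a *: x + y) /\ A (a *: x + y) = a *: A x + A y ;
  domain_dense : dense D ;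
  graph_closed : closed [set z : E * E | D z.1 /\ A z.1 = z.2] }.

Record C0_semigroup (S : R -> {linear E -> E}) : Prop := C0Semigroup {
  C0_bounded : forall t, 0 <= t -> continuous (S t) ;
  C0_id : forall x, S 0 x = x ;
  C0_morph : forall s t, 0 <= s -> 0 <= t -> forall x,
    S (s + t) x = S s (S t x) ;
  C0_strong : forall x, S t x @[t --> 0^'+] --> x }.

(* The graph of [A] on [D] is the graph of the infinitesimal generator. *)
Definition generator (S : R -> {linear E -> E}) D A : Prop :=
  forall x y, (D x /\ A x = y) <-> h^-1 *: (S h x - x) @[h --> 0^'+] --> y.

(* The families of intervals are finite and non-overlapping. *)
Definition abs_continuous (a b : R) u : Prop :=
  forall e, 0 < e -> exists2 delta, 0 < delta &
    forall n (s t : 'I_n -> R),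
      (forall i, [/\ a <= s i, s i <= t i & t i <= b]) ->
      (forall i j, i != j -> t i <= s j \/ t j <= s i) ->
      \sum_i (t i - s i) < delta ->
      \sum_i `|u (t i) - u (s i)| < e.

Definition simple_fun u : Prop :=
  finite_set (range u) /\ forall x, measurable (u @^-1` [set x]).

Definition strongly_measurable (I : set R) u : Prop :=
  exists2 s : nat -> R -> E, (forall n, simple_fun (s n)) &
    forall t, I t -> s n t @[n --> \oo] --> u t.

(* L^1(I; E) in the sense of Bochner. *)
Definition bochner_integrable (I : set R) u : Prop :=
  strongly_measurable I u /\
  (@lebesgue_measure R).-integrable I (fun t => `|u t|%:E).

(* C([0, T]; D), where [D] has the norm of [E]; values outside [0, T] play no
   role. *)
Definition C0T T D : set (R -> E) :=
  [set u | {within `[0, T], continuous u} /\ forall t, t \in `[0, T] -> D (u t)].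

Definition sup_norm T u : \bar R := ereal_sup [set `|u t|%:E | t in `[0, T]].

(* [v] is a representative of the a.e. derivative of [u]. *)
Definition strong_solution T D A (M : E -> E) f (g : E) u : Prop :=
  [/\ C0T T D u, abs_continuous 0 T u, u 0 = g &
    exists2 v, bochner_integrable `]0, T[ v &
      {ae @lebesgue_measure R, forall t, t \in `]0, T[ ->
        is_derive t 1 u (v t) /\ v t - A (u t) + M (u t) = f t}].

End evolution.

(* [gamma k] stands for the (k+1)-st entry of the multi-index. *)
Definition multi_index := {fsfun nat -> nat with 0%N}.

Definition weight (R : realType) (gamma : multi_index) : R :=
  \prod_(k <- finsupp gamma) (2 * k.+1)%:R ^+ gamma k.

(* A formal expansion is identified with the family of its coefficients. *)
Definition chaos (Y : Type) := multi_index -> Y.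

Section chaos.
Context (R : realType) (Y : Type).
Implicit Types (K : set Y) (nY : Y -> \bar R) (p : R) (F : chaos Y).
Local Open Scope ereal_scope.

(* [nY] is the norm of [Y]; it is extended real because the supremum norm of an
   arbitrary function may be infinite. *)
Definition chaos_norm nY p F : \bar R :=
  (\esum_(gamma in [set: multi_index])
     (nY (F gamma) ^+ 2 * (weight R gamma `^ (- p))%:E)) `^ 2^-1.

Definition in_chaos K nY p F : Prop :=
  (forall gamma, K (F gamma)) /\ chaos_norm nY p F < +oo.

Definition in_chaos_union K nY F : Prop :=
  exists2 p : R, (0 <= p)%R & in_chaos K nY p F.

End chaos.

Section regularization.
Context (R : realType) (d : nat).
Local Notation mu := (lebesgue_rV R d).
Implicit Types (phi q : 'rV[R]_d -> R) (l : R -> R).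

Definition partials (s : seq 'I_d) phi : 'rV[R]_d -> R :=
  foldr (fun i f => 'D_(delta_mx 0 i : 'rV[R]_d) f) phi s.

Definition smooth phi : Prop := forall s : seq 'I_d,
  continuous (partials s phi) /\
  forall i x, derivable (partials s phi) x (delta_mx 0 i).

Record mollifier phi : Prop := Mollifier {
  mollifier_smooth : smooth phi ;
  mollifier_support : compact (closure [set x | phi x != 0]) ;
  mollifier_ge0 : forall x, 0 <= phi x ;
  mollifier_int1 : (\int[mu]_x (phi x)%:E = 1)%E }.

Definition mollifying_net phi l (eps : R) : 'rV[R]_d -> R :=
  fun x => (l eps) ^- d * phi ((l eps)^-1 *: x).

Definition convolution (f g : 'rV[R]_d -> R) : 'rV[R]_d -> R :=
  fun x => \int[mu]_y (f y * g (x - y)).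

Definition regularizing_net q phi l (eps : R) : 'rV[R]_d -> R :=
  convolution q (mollifying_net phi l eps).

Definition Linfty_moderate (qe : R -> 'rV[R]_d -> R) : Prop :=
  exists (N : nat) (C : R), 0 < C /\
    forall eps, 0 < eps <= 1 -> qe eps \in Lfun mu +oo /\
      ('N[mu]_+oo[EFin \o qe eps] <= (C * eps ^- N)%:E)%E.

End regularization.

Section stochastic_problem.
Context (R : realType) (d : nat).
Local Notation H := (L2 R d).
Implicit Types (T : R) (D : set H) (A : H -> H) (r : 'rV[R]_d -> R).
Implicit Types (F U : chaos (R -> H)) (G : chaos H).

Definition process T U : Prop := in_chaos_union (C0T T setT) (sup_norm T) U.

Definition initial_datum D G : Prop :=
  in_chaos_union D (fun x : H => `|x|%:E) G.

Definition solution T D A r F G U : Prop :=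
  in_chaos_union (C0T T D) (sup_norm T) U /\
  forall gamma, strong_solution T D A (@Lmul _ _ _ _ _ _ r)
    (F gamma) (G gamma) (U gamma).

Definition moderate T (U : R -> chaos (R -> H)) : Prop :=
  exists pe : R -> R,
    let p := sup [set pe eps | eps in `]0, 1]] in
    [/\ forall eps, 0 < eps <= 1 ->
          0 <= pe eps /\ in_chaos (C0T T setT) (sup_norm T) (pe eps) (U eps),
        has_sup [set pe eps | eps in `]0, 1]],
        1 < p &
        exists (N : nat) (C : R), 0 < C /\ forall eps, 0 < eps <= 1 ->
          (chaos_norm (sup_norm T) p (U eps) <= (C * eps ^- N)%:E)%E].

Definition very_weak_solution T D A (qe : R -> 'rV[R]_d -> R) F G
    (U : R -> chaos (R -> H)) : Prop :=
  [/\ Linfty_moderate qe,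
      forall eps, 0 < eps <= 1 -> process T (U eps),
      forall eps, 0 < eps <= 1 -> solution T D A (qe eps) F G (U eps) &
      moderate T U].

End stochastic_problem.

(* Main.v *)
From HB Require Import structures.
Require Import Defs.
From mathcomp Require Import all_boot all_order all_algebra finmap.
From mathcomp Require Import all_classical all_reals all_analysis.
From mathcomp Require Import measurable_realfun ess_sup_inf lra ring.
Set Implicit Arguments.
Unset Strict Implicit.
Unset Printing Implicit Defensive.
Import Order.TTheory GRing.Theory Num.Theory.
Import numFieldNormedType.Exports.
Local Open Scope classical_set_scope.
Local Open Scope ring_scope.

(** Fix a multi-index, and let [v] and [u] be the corresponding coefficients of
    the solution for the potential [q] and of the one for its regularization
    [r].  Their difference [w] vanishes at time [0] and satisfies
    [w' = A w - r w - (r - q) v] almost everywhere, so that Duhamel's formula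
    and Gronwall's lemma give
      sup_t |w t| <= C sup_t |(r - q) (v t)|.
    The constant [C] only depends on [T], on a bound [M] of the semigroup on
    [[0, T]] and on an essential bound [Q] of [q]; as [r] averages [q] with a
    probability density, [Q] bounds [r] as well, and [C] is the same for all
    multi-indices and all parameters of the regularization
    ([strong_solutionB_bound]).

    For a fixed multi-index the right-hand side tends to [0]: [q] is continuous
    and the supports of the mollifiers shrink, so [r] tends to [q] pointwise
    ([regularizing_net_cvg]), hence [(r - q) u] tends to [0] in L^2 for every
    [u] by dominated convergence, uniformly for [u] in the compact set of the
    values of [v] ([Lmul_cvg0_uniform]).  It is moreover at most
    [2 C Q sup_t |v t|], and these suprema are square summable with the weights
    for which the unperturbed solution has a finite norm.  The theorem follows
    by dominated convergence for sums over multi-indices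
    ([esum_dominated_cvg0]).

    Two points need care.

    - Duhamel's formula.  A strong solution is only absolutely continuous and
      almost everywhere differentiable, and [A (w s)] need not be bounded in
      [s], so [s |-> S (t - s) (w s)] has no obvious regularity.  Instead of a
      vector-valued integral, the proof compares increments: a function whose
      increments near each point are dominated by those of a scalar function
      is dominated globally ([local_increment_bound]).  At points where the
      equation holds the increments are those predicted by the equation.  The
      other points form a null set, and [w s] is still in the domain of [A]
      there; their contribution is absorbed by nondecreasing functions of
      arbitrarily small total variation, one that is infinitely steep on the
      null set ([steep_function]) and one that majorizes the variation of [w]
      near it ([small_variation]).

    - The bound [M].  It comes from the Banach-Steinhaus theorem, which requires
      that L^2 be complete ([L2_complete]). *)

(** * Increments of functions of one variable *)

(** The set of the points up to which the bound holds contains its supremum,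
    by the hypothesis on the left of that point, and could be extended beyond
    it, by the hypothesis on its right, if it were not [b]. *)
Lemma local_increment_bound (R : realType) (E : normedModType R) (a b : R)
    (f : R -> E) (P : R -> R) : a <= b ->
  (forall s, a <= s <= b -> exists2 r : R, 0 < r & forall v, a <= v <= b ->
     `|v - s| < r ->
     (s <= v -> `|f v - f s| <= P v - P s) /\
     (v <= s -> `|f s - f v| <= P s - P v)) ->
  `|f b - f a| <= P b - P a.
Proof.
move=> ab loc.
pose G := [set c | a <= c <= b /\ `|f c - f a| <= P c - P a].
have Ga : G a by split; rewrite ?lexx // !subrr normr0.
have Gub : ubound G b by move=> c [/andP[]].
have Gs : has_sup G by split; [exists a | exists b].
set c := sup G.
have acb : a <= c <= b.
  by rewrite ub_le_sup //=; [apply: ge_sup => //; exists a | exists b].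
have [r r0 cr] := loc c acb.
have [u Gu uc] : exists2 u, G u & c - r < u by exact: sup_adherent.
have ule : u <= c by apply: ub_le_sup => //; exists b.
have Gc : `|f c - f a| <= P c - P a.
  case: Gu => uab fu.
  have [] := cr u uab; first by rewrite distrC ger0_norm ?subr_ge0 //; lra.
  move=> _ /(_ ule) fcu.
  rewrite -(subrKA (f u)) (le_trans (ler_normD _ _)) //.
  by rewrite -(subrKA (P u) (P c)) lerD.
have [->//|cb] := eqVneq b c.
have cltb : c < b by rewrite lt_neqAle eq_sym cb; case/andP: acb.
pose v := Num.min b (c + r / 2).
have cv : c < v by rewrite lt_min cltb ltrDl divr_gt0.
have vb : v <= b by rewrite ge_min lexx.
have vr : v - c < r.
  have : v <= c + r / 2 by rewrite ge_min lexx orbT.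
  by lra.
have vab : a <= v <= b by rewrite vb andbT; case/andP: acb; lra.
have [] := cr v vab; first by rewrite ger0_norm ?subr_ge0 ?ltW.
move=> /(_ (ltW cv)) fv _.
suff : v <= c by rewrite leNgt cv.
apply: ub_le_sup; first by exists b.
split=> //; rewrite -(subrKA (f c)) (le_trans (ler_normD _ _)) //.
by rewrite -(subrKA (P c) (P v)) lerD.
Qed.

(** Sum the Lebesgue measures of the traces on a half-line of open neighbourhoods
    of [N] of measure [e / 2 ^ n.+1].  A small interval around a point of [N]
    lies in as many of them as desired, and so counts that many times. *)
Lemma steep_function (R : realType) (N : set R) (e : R) : 0 < e ->
  (@lebesgue_measure R).-negligible N ->
  exists H : R -> R, [/\ {homo H : x y / x <= y},
    (forall x, 0 <= H x <= e) &
    forall s (K : R), N s -> exists2 r : R, 0 < r & forall u v,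
      s - r < u -> u <= v -> v < s + r -> K * (v - u) <= H v - H u].
Proof.
move=> e0 [B [mB B0 NB]].
pose mu : {measure set (measurableTypeR R) -> \bar R} := @lebesgue_measure R.
have /choice[Z HO] : forall n : nat, exists U : set R,
    [/\ open U, B `<=` U & (mu U <= (e / (2 ^ n.+1)%:R)%:E)%E].
  move=> n.
  have Bfin : (@lebesgue_measure R B < +oo)%E by rewrite [ltLHS]B0 ltry.
  have en0 : 0 < e / (2 ^ n.+1)%:R by rewrite divr_gt0 // ltr0n expn_gt0.
  have [U [oU BU Ue]] := lebesgue_regularity_outer mB Bfin en0.
  exists U; split => //; apply: ltW; apply: le_lt_trans Ue.
  have mU : measurable U by exact: open_measurable.
  rewrite -[in leLHS](setDUK BU) measureU ?setDIK //; last exact: measurableD.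
  by rewrite [X in (X + _)%E]B0 add0e lexx.
have mO n : measurable (Z n : set (measurableTypeR R)).
  by apply: open_measurable; case: (HO n).
(* The distribution function of the finite measure [m] is the witness. *)
pose nu (n : nat) : {measure set _ -> \bar R} := mrestr mu (mO n).
pose m : {measure set _ -> \bar R} := mseries nu 0.
have nuE n (A : set (measurableTypeR R)) : nu n A = mu (A `&` Z n) by [].
have mE (A : set (measurableTypeR R)) : m A = (\sum_(0 <= n <oo) nu n A)%E by [].
have mT (A : set (measurableTypeR R)) : measurable A -> (m A <= e%:E)%E.
  move=> mA; rewrite mE.
  apply: le_trans (epsilon_trick0 xpredT (ltW e0)).
  apply: lee_nneseries => n _ //; rewrite nuE.
  have [_ _] := HO n; apply: le_trans; apply: le_measure; rewrite ?inE //;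
    first [exact: mO|exact: measurableI].
have mfin (A : set (measurableTypeR R)) : measurable A -> m A \is a fin_num.
  by move=> mA; rewrite ge0_fin_numE // (le_lt_trans (mT _ mA)) ?ltry.
exists (fun x => fine (m `]-oo, x]%classic)); split.
- move=> x y xy; rewrite fine_le ?mfin // le_measure ?inE //.
  by apply: subset_itvl; rewrite bnd_simp.
- move=> x; rewrite fine_ge0 //= -lee_fin fineK ?mfin //.
  exact: mT.
move=> s K Ns.
pose n := (Num.truncn `|K|).+1.
have lKn : K <= n%:R by rewrite (le_trans (ler_norm _)) // ltW // truncnS_gt.
have [r r0 Hr] : exists2 r : R, 0 < r &
    forall k, (k < n)%N -> forall x, s - r < x < s + r -> Z k x.
  elim: n {lKn} => [|j [r r0 IH]]; first by exists 1.
  have [oU BU _] := HO j.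
  have /nbhs_ballP[r' /= r'0 br'] : nbhs s (Z j).
    by apply: open_nbhs_nbhs; split => //; apply: BU; exact: NB.
  exists (Num.min r r'); first by rewrite lt_min r0.
  have mr : Num.min r r' <= r by rewrite ge_min lexx.
  have mr' : Num.min r r' <= r' by rewrite ge_min lexx orbT.
  move=> k; rewrite ltnS leq_eqVlt => /predU1P[->|kj] x xs.
    by apply: br'; rewrite -ball_normE /= ltr_norml; lra.
  by apply: IH => //; lra.
exists r => // u v su uv vs.
have mu_uv : (m `]u, v]%classic >= (n%:R * (v - u))%:E)%E.
  rewrite mE (nneseries_split 0 n) // add0n.
  rewrite -[leLHS]adde0 leeD ?nneseries_ge0 //.
  rewrite (eq_big_nat _ _ (F2 := fun=> (v - u)%:E)); last first.
    move=> k /andP[_ kn]; rewrite nuE setIidl.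
      have := lebesgue_measure_itv `]u, v]; rewrite /= lte_fin.
      by move=> ->; case: ltgtP uv => // -> _; rewrite subrr.
    by move=> x /=; rewrite in_itv /= => /andP[ux xv]; apply: (Hr k) => //; lra.
  by rewrite sumEFin sumr_const_nat subn0 mulr_natl.
rewrite (le_trans (ler_wpM2r _ lKn)) ?subr_ge0 // -lee_fin.
apply: le_trans mu_uv _.
rewrite EFinB !fineK ?mfin // leeBrDr ?mfin // addeC -measureU //; last 1 first.
  by rewrite -subset0 => x /= []; rewrite !in_itv /= => xu /andP[]; lra.
rewrite le_measure ?inE //; first exact: measurableU.
by move=> x /= []; rewrite !in_itv /=; lra.
Qed.

(** [H] plays the role of a clock: [W c] is the largest variation of [u] over a
    family of intervals in [[a, c]] whose total length is at most the increment
    of [H] on [[a, c]].  Absolute continuity bounds it by [e] as soon as the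
    total increment of [H] is small, and an interval on which [H] grows at
    least as fast as the identity can always be added to a family. *)
Lemma small_variation (R : realType) (E : normedModType R) (a b : R)
    (u : R -> E) (e : R) : 0 < e -> abs_continuous a b u ->
  exists2 delta, 0 < delta & forall H : R -> R, {homo H : x y / x <= y} ->
    (forall x, 0 <= H x <= delta) ->
    exists W : R -> R, [/\ forall x, a <= x <= b -> 0 <= W x <= e,
      forall x y, a <= x -> x <= y -> y <= b -> W x <= W y &
      forall x y, a <= x -> x <= y -> y <= b -> y - x <= H y - H x ->
        `|u y - u x| <= W y - W x].
Proof.
move=> e0 /(_ e e0)[delta delta0 ac].
exists (delta / 2); first by rewrite divr_gt0.
move=> H ndH Hd.
pose fam c n (s t : 'I_n -> R) := [/\
  forall i, [/\ a <= s i, s i <= t i & t i <= c],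
  forall i j, i != j -> t i <= s j \/ t j <= s i &
  \sum_i (t i - s i) <= H c - H a].
pose sums c := [set x | exists n (s t : 'I_n -> R),
  fam c n s t /\ x = \sum_i `|u (t i) - u (s i)|].
have sums0 c : a <= c -> sums c 0.
  move=> ac'; exists 0%N, (fun=> 0), (fun=> 0); split; last by rewrite big_ord0.
  by split=> [[]|[]|] //; rewrite big_ord0 subr_ge0 ndH.
have sums_ub c : c <= b -> ubound (sums c) e.
  move=> cb x [n [s [t [[st ov len]] ->]]]; apply/ltW/ac => //.
    by move=> i; case: (st i) => ? ? ?; split => //; lra.
  by apply: le_lt_trans len _; move: (Hd a) (Hd c); lra.
have hs c : a <= c -> c <= b -> has_sup (sums c).
  by move=> ac' cb; split; [exists 0; exact: sums0 | exists e; exact: sums_ub].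
have famS x y n s t : x <= y -> fam x n s t -> fam y n s t.
  move=> xy [st ov len]; split => //.
    by move=> i; case: (st i) => ? ? ?; split => //; lra.
  by apply: le_trans len _; rewrite lerB ?ndH.
exists (fun c => sup (sums c)); split.
- move=> x /andP[ax xb]; rewrite ub_le_sup /=; first last.
  + exact: sums0.
  + by exists e; exact: sums_ub.
  + by apply: ge_sup; [exists 0; exact: sums0 | exact: sums_ub].
- move=> x y ax xy yb; apply: le_sup; last 2 first.
  + by exists 0; exact: sums0.
  + by apply: hs => //; lra.
  move=> _ [n [s [t [f ->]]]]; apply/downP.
  exists (\sum_i `|u (t i) - u (s i)|) => //; exists n, s, t.
  by split => //; exact: famS f.
move=> x y ax xy yb yx; rewrite lerBrDr -lerBrDl.
apply: ge_sup; first by exists 0; exact: sums0.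
move=> _ [n [s [t [[st ov len] ->]]]]; rewrite lerBrDl.
apply: ub_le_sup; first by exists e; exact: sums_ub.
(* the family with the interval [[x, y]] added in front *)
pose ext z (g : 'I_n -> R) (i : 'I_n.+1) := oapp g z (unlift ord0 i).
exists n.+1, (ext x s), (ext y t); split; last first.
  rewrite big_ord_recl /ext unlift_none /=; congr (_ + _).
  by apply: eq_bigr => i _; rewrite liftK.
split.
- move=> i; rewrite /ext; case: unliftP => [j _|_] /=; last by split.
  by case: (st j) => ? ? ?; split => //; lra.
- move=> i j; rewrite /ext; case: unliftP => [i' ->|->]; case: unliftP => [j' ->|->] //=.
  + by rewrite (inj_eq lift_inj); exact: ov.
  + by left; case: (st i').
  + by right; case: (st j').
rewrite big_ord_recl /ext unlift_none /=.
under eq_bigr do rewrite liftK.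
by move: len yx; lra.
Qed.

Lemma derive_increment (R : realType) (E : normedModType R) (u : R -> E)
    (s : R) (v : E) (e : R) : is_derive s 1 u v -> 0 < e ->
  exists2 r : R, 0 < r & forall y, `|y - s| < r ->
    `|u y - u s - (y - s) *: v| <= e * `|y - s|.
Proof.
move=> [du dv] e0.
have /cvgrPdist_le/(_ _ e0) : h^-1 *: (u (h *: 1 + s) - u s) @[h --> 0^'] --> v.
  by rewrite -dv; exact: du.
rewrite near_withinE => /nbhs_ballP[r /= r0 H].
exists r => // y ysr.
have [->|ys] := eqVneq y s; first by rewrite !subrr scale0r subrr !normr0 mulr0.
have ys0 : y - s != 0 by rewrite subr_eq0.
have := H (y - s); rewrite -ball_normE /= sub0r normrN => /(_ ysr ys0).
rewrite [_ *: 1]mulr1 subrK => {}H.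
rewrite -[X in `|X - _|](scale1r) -(divff ys0) -scalerA -scalerBr normrZ mulrC.
by rewrite ler_wpM2r // distrC.
Qed.

Lemma right_increment (R : realType) (E : normedModType R)
    (S : R -> {linear E -> E}) (x y : E) (e : R) :
  (forall x, S 0 x = x) -> h^-1 *: (S h x - x) @[h --> 0^'+] --> y -> 0 < e ->
  exists2 r : R, 0 < r & forall h, 0 <= h < r -> `|S h x - x - h *: y| <= e * h.
Proof.
move=> S0 /cvgrPdist_le/[apply]; rewrite near_withinE => /nbhs_ballP[r /= r0 H].
exists r => // h /andP[]; rewrite le_eqVlt => /predU1P[<- _|h0 hr].
  by rewrite S0 subrr scale0r subrr normr0 mulr0.
have := H h; rewrite -ball_normE /= sub0r normrN gtr0_norm // => /(_ hr h0) {}H.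
rewrite -[X in `|X - _|](scale1r) -(divff (lt0r_neq0 h0)) -scalerA -scalerBr normrZ.
by rewrite gtr0_norm // mulrC; apply: ler_wpM2r; [exact: ltW | rewrite distrC].
Qed.

Lemma strong_increment (R : realType) (E : normedModType R) (S : R -> {linear E -> E})
    (x : E) (e : R) : (forall x, S 0 x = x) -> S h x @[h --> 0^'+] --> x -> 0 < e ->
  exists2 r : R, 0 < r & forall h, 0 <= h < r -> `|S h x - x| <= e.
Proof.
move=> S0 /cvgrPdist_le H e0; move: (H _ e0).
rewrite near_withinE => /nbhs_ballP[r /= r0 {}H].
exists r => // h /andP[]; rewrite le_eqVlt => /predU1P[<- _|h0 hr].
  by rewrite S0 subrr normr0 ltW.
rewrite distrC; apply: H => //.
by rewrite -ball_normE /= sub0r normrN gtr0_norm.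
Qed.

(** * Strong solutions and the semigroup *)

Section mild_increments.
Context (R : realType) (E : normedModType R).
Variables (S : R -> {linear E -> E}) (D : set E) (A : E -> E) (T M : R).
Hypothesis S_C0 : C0_semigroup S.
Hypothesis S_gen : generator S D A.
Hypothesis S_le : forall (t : R) (x : E), 0 <= t <= T -> `|S t x| <= M * `|x|.

(** Here and in the next lemma [v] stands for the derivative of the solution and
    [a] for the value of the generator at [x]; the first terms are the errors
    of the two first-order expansions at [x]. *)
Lemma mild_step_right (x y v a : E) (h : R) : 0 <= h ->
  `|y - S h x| <= `|y - x - h *: v| + `|S h x - x - h *: a| + h * `|v - a|.
Proof.
move=> h0.
have -> : y - S h x = (y - x - h *: v) - (S h x - x - h *: a) + h *: (v - a).
  rewrite scalerBr (opprD (S _ _ - _)) (addrACA (y - x)) opprB subrKA opprK.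
  by rewrite -[RHS]addrA [X in _ = _ + X]addrACA addNr subrr !addr0.
rewrite (le_trans (ler_normD _ _)) // normrZ ger0_norm // lerD2r.
exact: ler_normB.
Qed.

Lemma mild_step_left (x y v a : E) (h : R) : 0 <= h <= T ->
  `|x - S h y| <= M * `|y - x + h *: v| + h * `|S h v - v| +
    `|S h x - x - h *: a| + h * `|v - a|.
Proof.
move=> hT; have /andP[h0 _] := hT.
have -> : x - S h y = - S h (y - x + h *: v) + h *: (S h v - v)
    - (S h x - x - h *: a) + h *: (v - a).
  have -> : S h (y - x + h *: v) = S h y - S h x + h *: S h v.
    by rewrite addrC [LHS](linearP (S h)) [RHS]addrC (raddfB (S h)).
  rewrite !scalerBr.
  move: (S h x) (S h y) (h *: S h v) (h *: v) (h *: a) => x' y' z p q.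
  rewrite (opprD (y' - x')) (opprB y' x'). rewrite subrKA.
  rewrite (opprD (x' - x)) (addrACA (x' - y')) opprB (addrC (x' - y')) subrKA opprK.
  by rewrite -[RHS]addrA [X in _ = _ + X]addrACA addNr subrr !addr0.
rewrite (le_trans (ler_normD _ _)) // normrZ ger0_norm // lerD2r.
rewrite (le_trans (ler_normB _ _)) // lerD2r.
rewrite (le_trans (ler_normD _ _)) // normrZ ger0_norm // lerD2r normrN.
exact: S_le.
Qed.

(** Since [S (t - u) (w u) - S (t - s) (w s)] is the image of
    [w u - S (u - s) (w s)] under [S (t - u)], this bounds its increments at a
    point where [w] is differentiable. *)
Lemma mild_increment_differentiable (w : R -> E) (s e c : R) (v : E) :
  0 <= M -> 0 < e -> D (w s) -> is_derive s 1 w v -> `|v - A (w s)| <= c ->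
  exists2 r : R, 0 < r & forall u, `|u - s| < r -> `|u - s| <= T ->
    (s <= u -> `|w u - S (u - s) (w s)| <= (u - s) * (c + 2 * e)) /\
    (u <= s -> `|w s - S (s - u) (w u)| <= (s - u) * (c + (M + 2) * e)).
Proof.
move=> M0 e0 Ds dv vc.
have S0 := C0_id S_C0.
have gs := (S_gen (w s) (A (w s))).1 (conj Ds erefl).
have [r1 r10 Hr1] := right_increment S0 gs e0.
have [r2 r20 Hr2] := derive_increment dv e0.
have [r3 r30 Hr3] := strong_increment S0 (C0_strong S_C0 (x := v)) e0.
exists (Num.min r1 (Num.min r2 r3)); first by rewrite !lt_min r10 r20.
move=> u; rewrite !lt_min => /and3P[us1 us2 us3] uT; have {Hr2} := Hr2 u us2.
split=> us.
  have h0 : 0 <= u - s by rewrite subr_ge0.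
  move: H us1; rewrite (ger0_norm h0) => H us1.
  apply: le_trans (mild_step_right _ _ v (A (w s)) h0) _.
  have H1 : `|S (u - s) (w s) - w s - (u - s) *: A (w s)| <= e * (u - s).
    by apply: Hr1; rewrite h0.
  have H2 : (u - s) * `|v - A (w s)| <= (u - s) * c by rewrite ler_wpM2l.
  by clear - H H1 H2; lra.
have h0 : 0 <= s - u by rewrite subr_ge0.
move: H us1 us3 uT; rewrite (distrC u s) (ger0_norm h0) => H us1 us3 uT.
have hT : 0 <= s - u <= T by rewrite h0.
apply: le_trans (mild_step_left _ _ v (A (w s)) hT) _.
have H1 : `|S (s - u) (w s) - w s - (s - u) *: A (w s)| <= e * (s - u).
  by apply: Hr1; rewrite h0.
have H2 : (s - u) * `|v - A (w s)| <= (s - u) * c by rewrite ler_wpM2l.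
have H3 : (s - u) * `|S (s - u) v - v| <= (s - u) * e.
  by rewrite ler_wpM2l //; apply: Hr3; rewrite h0.
have H4 : M * `|w u - w s + (s - u) *: v| <= M * (e * (s - u)).
  by rewrite -[X in X *: v](opprB u s) scaleNr ler_wpM2l.
by clear - H1 H2 H3 H4; lra.
Qed.

(** The analogue at a point where [w] is not known to be differentiable: it is
    enough that [w s] be in the domain of the generator, and the increment of
    [w] stays in the bound. *)
Lemma mild_increment_domain (w : R -> E) (s e : R) :
  0 < e -> D (w s) ->
  exists2 r : R, 0 < r & forall u, `|u - s| < r -> `|u - s| <= T ->
    (s <= u -> `|w u - S (u - s) (w s)| <=
       `|w u - w s| + (u - s) * (`|A (w s)| + e)) /\
    (u <= s -> `|w s - S (s - u) (w u)| <=
       M * `|w s - w u| + (s - u) * (`|A (w s)| + e)).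
Proof.
move=> e0 Ds.
have gs := (S_gen (w s) (A (w s))).1 (conj Ds erefl).
have [r r0 Hr] := right_increment (C0_id S_C0) gs e0.
exists r => // u us uT.
have key h : 0 <= h < r -> `|S h (w s) - w s| <= h * (`|A (w s)| + e).
  move=> hr; have /andP[h0 _] := hr.
  have := Hr h hr; set z := S h (w s) - w s => zh.
  rewrite -(subrK (h *: A (w s)) z) (le_trans (ler_normD _ _)) //.
  by rewrite normrZ ger0_norm // mulrDr [leRHS]addrC (mulrC h e) lerD2r.
split=> su.
  have h0 : 0 <= u - s by rewrite subr_ge0.
  move: us; rewrite (ger0_norm h0) => us.
  rewrite -(subrKA (w s)) (le_trans (ler_normD _ _)) // lerD2l distrC.
  by apply: key; rewrite h0.
have h0 : 0 <= s - u by rewrite subr_ge0.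
move: us uT; rewrite (distrC u s) (ger0_norm h0) => us uT.
have -> : w s - S (s - u) (w u) = S (s - u) (w s - w u) - (S (s - u) (w s) - w s).
  by rewrite raddfB opprB [RHS]addrC subrKA.
apply: le_trans (ler_normB _ _) _; apply: lerD; first by apply: S_le; rewrite h0.
by apply: key; rewrite h0.
Qed.

End mild_increments.

(** This replaces Duhamel's formula
    [w t = S t (w 0) + \int_0^t S (t - s) (w' s - A (w s)) ds] together with
    the estimate of its integral.  Up to an error proportional to [e], the
    increments of [s |-> S (t - s) (w s)] are bounded near each point by those
    of [P]: the first two terms of [P] serve at the points where the equation
    holds, the last two on the exceptional null set [N]. *)
Lemma duhamel_bound (R : realType) (E : normedModType R)
    (S : R -> {linear E -> E}) (D : set E) (A : E -> E) (T M : R)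
    (w : R -> E) (c psi : R -> R) :
  C0_semigroup S -> generator S D A -> 1 <= M ->
  (forall (t : R) (x : E), 0 <= t <= T -> `|S t x| <= M * `|x|) ->
  abs_continuous 0 T w -> (forall s : R, 0 <= s <= T -> D (w s)) ->
  {ae @lebesgue_measure R, forall s : R, s \in `]0, T[ ->
     exists2 v, is_derive s 1 w v & `|v - A (w s)| <= c s} ->
  {homo psi : x y / x <= y} -> (forall s : R, is_derive s 1 psi (c s)) ->
  forall t : R, 0 <= t <= T -> `|w t - S t (w 0)| <= M * (psi t - psi 0).
Proof.
move=> S_C0 S_gen M1 S_le acw Dw aew ndpsi dpsi t /andP[t0 tT].
have M0 : 0 <= M by rewrite (le_trans ler01).
(* an upper bound of the total error divided by [e] *)
pose C := M * ((M + 3) * t + M + 1).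
have C0 : 0 <= C by rewrite mulr_ge0 // !addr_ge0 // mulr_ge0 // addr_ge0.
suff main (e : R) : 0 < e -> `|w t - S t (w 0)| <= M * (psi t - psi 0) + C * e.
  apply/ler_addgt0Pr => e e0; have C1 : 0 < C + 1 by rewrite ltr_wpDl.
  have /main/le_trans : 0 < e / (C + 1) by rewrite divr_gt0.
  apply; rewrite lerD2l mulrA ler_pdivrMr // mulrC ler_pM2l //.
  by rewrite lerDl.
move=> e0.
have Me3 : 0 <= (M + 3) * e by rewrite mulr_ge0 ?(ltW e0) // addr_ge0.
have [delta delta0 smallW] := small_variation e0 acw.
(* The endpoints are put in [N]: differentiability is only known inside. *)
pose N := ~` [set s : R | s \in `]0, T[ ->
     exists2 v, is_derive s 1 w v & `|v - A (w s)| <= c s] `|` [set 0] `|` [set T].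
have negN : (@lebesgue_measure R).-negligible N.
  apply: negligibleU; last first.
    by exists [set T]; split => //; exact: lebesgue_measure_set1.
  apply: negligibleU; last first.
    by exists [set 0]; split => //; exact: lebesgue_measure_set1.
  exact: aew.
have [|H [ndH He Hsteep]] := steep_function _ negN (e := Num.min e delta).
  by rewrite lt_min e0.
have Hle (x : R) : 0 <= H x <= e /\ 0 <= H x <= delta.
  by have := He x; rewrite le_min => /and3P[-> -> ->].
have [W [Wle ndW Wvar]] := smallW H ndH (fun x => (Hle x).2).
have incr (u v : R) : 0 <= u -> u <= v -> v <= t ->
    `|S (t - v) (w v) - S (t - u) (w u)| <= M * `|w v - S (v - u) (w u)|.
  move=> u0 uv vt.
  have -> : t - u = (t - v) + (v - u) by rewrite subrKA.
  rewrite (@C0_morph _ _ _ S_C0 (t - v) (v - u)) ?subr_ge0 // -raddfB.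
  by apply: S_le; rewrite subr_ge0 vt; clear - u0 uv vt tT; lra.
pose P x := M * (psi x + (M + 3) * e * x + M * W x + H x).
have Pmono (u v : R) k : 0 <= u -> u <= v -> v <= t ->
    `|w v - S (v - u) (w u)| <= k ->
    k <= (psi v + (M + 3) * e * v + M * W v + H v) -
         (psi u + (M + 3) * e * u + M * W u + H u) ->
    `|S (t - v) (w v) - S (t - u) (w u)| <= P v - P u.
  move=> u0 uv vt wk kP; apply: le_trans (incr u v u0 uv vt) _.
  by rewrite /P -mulrBr ler_wpM2l // (le_trans wk).
have := @local_increment_bound R E 0 t (fun s => S (t - s) (w s)) P t0.
rewrite /= subrr (C0_id S_C0) subr0 => lib.
have /le_trans : `|w t - S t (w 0)| <= P t - P 0.
  apply: lib => s /andP[s0 st].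
  have sT : 0 <= s <= T by rewrite s0 (le_trans st).
  have Ds := Dw s sT.
  have dist (v : R) : 0 <= v <= t -> `|v - s| <= T.
    by rewrite ler_norml; clear - s0 st tT; lra.
  have nW (u v : R) : 0 <= u -> u <= v -> v <= t -> M * W u <= M * W v.
    move=> u0 uv vt; rewrite ler_wpM2l // ndW //.
    by rewrite (le_trans vt).
  have [Ns|Ns] := pselect (N s).
    have [r1 r10 Hr1] := mild_increment_domain S_C0 S_gen S_le e0 Ds.
    have [r2 r20 Hr2] := Hsteep s (`|A (w s)| + e + 1) Ns.
    (* Near [s] the slope of [H] exceeds both [1], as [W] requires, and the norm
   of the difference quotients of the semigroup at [w s]. *)
have slope (u v : R) : s - r2 < u -> u <= v -> v < s + r2 ->
        v - u <= H v - H u /\ (v - u) * (`|A (w s)| + e) <= H v - H u.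
      move=> su uv vs; have Hv := Hr2 u v su uv vs.
      have vu0 : 0 <= v - u by rewrite subr_ge0.
      split; apply: le_trans Hv.
        by rewrite ler_peMl // lerDr addr_ge0 // ltW.
      by rewrite mulrC ler_wpM2r // lerDl.
    exists (Num.min r1 r2); first by rewrite lt_min r10.
    move=> v v0t; rewrite lt_min => /andP[vs1 vs2].
    have [Hright Hleft] := Hr1 v vs1 (dist v v0t).
    move: vs2; rewrite ltr_norml => vs2; have /andP[v0 vt] := v0t.
    split=> [sv|vs].
      apply: (Pmono s v _ s0 sv vt (Hright sv)).
      have [|||H1 H2] := slope s v; [by clear - vs2 sv; lra .. |].
      have W1 := Wvar s v s0 sv (le_trans vt tT) H1.
      have W2 : W v - W s <= M * W v - M * W s.
        by rewrite -mulrBr ler_peMl // (le_trans _ W1).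
      have ev : (M + 3) * e * s <= (M + 3) * e * v by rewrite ler_wpM2l.
      have np := ndpsi _ _ sv.
      by clear - H2 W1 W2 ev np; lra.
    apply: (Pmono v s _ v0 vs st (Hleft vs)).
    have [|||H1 H2] := slope v s; [by clear - vs2 vs; lra .. |].
    have W1 := Wvar v s v0 vs (le_trans st tT) H1.
    have W2 : M * `|w s - w v| <= M * W s - M * W v by rewrite -mulrBr ler_wpM2l.
    have ev : (M + 3) * e * v <= (M + 3) * e * s by rewrite ler_wpM2l.
    have np := ndpsi _ _ vs.
    by clear - H2 W2 ev np; lra.
  have [v' dv vc] : exists2 v, is_derive s 1 w v & `|v - A (w s)| <= c s.
    have s0' : s != 0 by apply: contra_notN Ns => /eqP ->; left; right.
    have sT' : s != T by apply: contra_notN Ns => /eqP ->; right.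
    apply: contrapT => nex; apply: Ns; left; left => /= K; apply: nex; apply: K.
    by rewrite in_itv /= lt_neqAle eq_sym s0' s0 /= lt_neqAle sT'; case/andP: sT.
  have [r1 r10 Hr1] := mild_increment_differentiable S_C0 S_gen S_le M0 e0 Ds dv vc.
  have [r2 r20 Hr2] := derive_increment (dpsi s) e0.
  exists (Num.min r1 r2); first by rewrite lt_min r10.
  move=> v v0t; rewrite lt_min => /andP[vs1 vs2].
  have [Hright Hleft] := Hr1 v vs1 (dist v v0t).
  have {Hr2} := Hr2 v vs2; rewrite ler_norml => /andP[Hr2 Hr3].
  have /andP[v0 vt] := v0t.
  split=> [sv|vs].
    apply: (Pmono s v _ s0 sv vt (Hright sv)).
    have W1 := nW s v s0 sv vt; have nH := ndH _ _ sv.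
    have Me : 0 <= M * e * (v - s) by rewrite !mulr_ge0 ?subr_ge0 // ltW.
    move: Hr2; rewrite ger0_norm ?subr_ge0 // /GRing.scale /= => Hr2.
    by clear - Hr2 W1 nH Me; lra.
  apply: (Pmono v s _ v0 vs st (Hleft vs)).
  have W1 := nW v s v0 vs st; have nH := ndH _ _ vs.
  move: Hr3; rewrite ler0_norm ?subr_le0 // /GRing.scale /= => Hr3.
  by clear - Hr3 W1 nH; lra.
apply.
have -> : M * (psi t - psi 0) + C * e =
    M * (psi t - psi 0 + ((M + 3) * t + M + 1) * e) by rewrite /C; ring.
rewrite /P -mulrBr ler_wpM2l //.
have /andP[_ Wt] : 0 <= W t <= e by apply: Wle; rewrite t0.
have /andP[W0 _] : 0 <= W 0 <= e by apply: Wle; rewrite lexx (le_trans t0).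
have MW : M * (W t - W 0) <= M * e.
  by rewrite ler_wpM2l // lerBlDr (le_trans Wt) // lerDl.
have [/andP[_ Ht] _] := Hle t; have [/andP[H0 _] _] := Hle 0.
by clear - Ht H0 MW; lra.
Qed.

(** Let [K] be the maximum of [expR (- lam * s) * |w s|].  Feeding the bound
    [|w s| <= K * expR (lam * s)] into [duhamel_bound] gives
    [K <= M * Q / lam * K + M * delta * T], and [lam] is chosen such that the
    first term is at most [K / 2]. *)
Lemma gronwall_bound (R : realType) (E : normedModType R)
    (S : R -> {linear E -> E}) (D : set E) (A : E -> E) (T M : R)
    (w : R -> E) (Q delta : R) :
  C0_semigroup S -> generator S D A -> 1 <= M ->
  (forall (t : R) (x : E), 0 <= t <= T -> `|S t x| <= M * `|x|) ->
  0 <= Q -> 0 <= delta ->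
  {within `[0, T], continuous w} -> w 0 = 0 ->
  abs_continuous 0 T w -> (forall s : R, 0 <= s <= T -> D (w s)) ->
  {ae @lebesgue_measure R, forall s : R, s \in `]0, T[ ->
     exists2 v, is_derive s 1 w v & `|v - A (w s)| <= Q * `|w s| + delta} ->
  forall t : R, 0 <= t <= T ->
    `|w t| <= 2 * M * T * expR ((2 * M * Q + 1) * T) * delta.
Proof.
move=> S_C0 S_gen M1 S_le Q0 d0 cw w0 acw Dw aew t tT.
have T0 : 0 <= T by lra.
have M0 : 0 < M by rewrite (lt_le_trans _ M1).
set lam := 2 * M * Q + 1.
have MQ : 0 <= M * Q by rewrite mulr_ge0 // ltW.
have lam0 : 0 < lam by rewrite /lam; lra.
pose g s := expR (- (lam * s)) * `|w s|.
have cg : {within `[0, T], continuous g}.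
  apply/subspace_continuousP => x xT; apply: cvgM; last first.
    by apply: cvg_norm; move/subspace_continuousP : cw; exact.
  apply: cvg_within_filter.
  apply: (@continuous_comp _ _ _ (fun s => - (lam * s)) expR); last exact: continuous_expR.
  by apply: continuousN; apply: continuousM; [exact: cst_continuous|exact: cvg_id].
have [c] := EVT_max T0 cg; rewrite in_itv /= => cT gmax.
set K := g c in gmax.
have K0 : 0 <= K by rewrite mulr_ge0 // expR_ge0.
have wK (s : R) : 0 <= s <= T -> `|w s| <= K * expR (lam * s).
  move=> sT; have := gmax s; rewrite in_itv /= => /(_ sT).
  by rewrite /g expRN mulrC ler_pdivrMr // expR_gt0.
have KE : K = expR (- (lam * c)) * `|w c| by [].
clearbody K.
pose psi s := Q * K / lam * expR (lam * s) + delta * s.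
have dpsi (s : R) : is_derive s 1 psi (Q * K * expR (lam * s) + delta).
  rewrite (_ : psi = (Q * K / lam) \*: (expR \o (lam \*: id)) + delta \*: id); last by [].
  apply: is_derive_eq.
  by rewrite /GRing.scale /=; field; rewrite gt_eqF.
have ndpsi : {homo psi : x y / x <= y}.
  move=> x y xy; apply: lerD; last by rewrite ler_wpM2l.
  apply: ler_wpM2l; first by rewrite divr_ge0 ?mulr_ge0 ?(ltW lam0).
  by rewrite ler_expR ler_wpM2l ?(ltW lam0).
have aew' : {ae @lebesgue_measure R, forall s : R, s \in `]0, T[ ->
     exists2 v, is_derive s 1 w v & `|v - A (w s)| <= Q * K * expR (lam * s) + delta}.
  apply: negligibleS aew => s /=; apply: contra_not => H sT.
  have [v dv vle] := H sT; exists v => //.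
  apply: le_trans vle _; rewrite lerD2r -mulrA ler_wpM2l //; apply: wK.
  by move: sT; rewrite in_itv /= => /andP[/ltW -> /ltW ->].
have KdT : K <= 2 * M * delta * T.
  have := duhamel_bound S_C0 S_gen M1 S_le acw Dw aew' ndpsi dpsi cT.
  rewrite w0 linear0 subr0 /psi !mulr0 expR0 addr0 mulr1 => wc.
  have : K <= expR (- (lam * c)) * (M * (Q * K / lam * expR (lam * c) + delta * c)).
    rewrite [leLHS]KE ler_wpM2l ?expR_ge0 // (le_trans wc) // ler_wpM2l ?(ltW M0) //.
    by rewrite gerBl divr_ge0 ?mulr_ge0 ?(ltW lam0).
  have -> : expR (- (lam * c)) * (M * (Q * K / lam * expR (lam * c) + delta * c)) =
      M * Q / lam * K + M * delta * (c * expR (- (lam * c))).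
    rewrite mulrDr mulrDr; congr (_ + _); rewrite mulrC -!mulrA //.
    by rewrite expRxMexpNx_1 mulr1 (mulrC K).
  have : M * Q / lam * K <= K / 2.
    rewrite mulrC ler_wpM2l // ler_pdivrMr // /lam; lra.
  have : M * delta * (c * expR (- (lam * c))) <= M * delta * T.
    have /andP[c0 cT'] := cT.
    rewrite ler_wpM2l ?mulr_ge0 ?(ltW M0) // (le_trans _ cT') // ler_piMr //.
    by rewrite -expR0 ler_expR oppr_le0 mulr_ge0 ?(ltW lam0).
  by clear; lra.
apply: le_trans (wK t tT) _.
have -> : 2 * M * T * expR (lam * T) * delta = 2 * M * delta * T * expR (lam * T) by ring.
by rewrite ler_pM ?expR_ge0 // ler_expR ler_wpM2l ?(ltW lam0) //; case/andP: tT.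
Qed.

(** * Uniform bounds for the semigroup *)

(** If no interval [[0, 1 / n.+1]] carried a uniform bound, there would be times
    [t n] tending to [0] with [S (t n)] of norm at least [n]; this contradicts
    the Banach-Steinhaus theorem, because [S (t n) x] tends to [x].  The
    semigroup property extends the bound to [[0, T]]. *)
Lemma semigroup_bound (R : realType) (E : completeNormedModType R)
    (S : R -> {linear E -> E}) (T : R) : C0_semigroup S ->
  exists2 M : R, 1 <= M & forall (t : R) (x : E), 0 <= t <= T -> `|S t x| <= M * `|x|.
Proof.
move=> S_C0.
have [n0 [C HC]] : exists n0 : nat, exists C : R,
    forall (t : R) x, 0 <= t <= n0.+1%:R^-1 -> `|S t x| <= C * `|x|.
  apply: contrapT => /forallNP nb.
  have /choice[t Ht] : forall n : nat, exists t : R, 0 <= t <= n.+1%:R^-1 /\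
      exists x, n%:R * `|x| < `|S t x|.
    move=> n; have /forallNP/(_ n%:R)/existsNP[t /existsNP[x /not_implyP[tn /negP]]] := nb n.
    by rewrite -ltNge => h; exists t; split => //; exists x.
  have [] := @Banach_Steinhauss R E E [set f : E -> E | exists n, f = S (t n)] _ _ 1.
  - move=> _ [n ->]; split; last by move=> a x y; rewrite linearP.
    have /andP[tn0 _] := (Ht n).1.
    have /linear_bounded_continuous/linear_boundedP/pinfty_ex_gt0[r r0 Sr] :=
      C0_bounded S_C0 tn0.
    by move=> k; exists (r * k) => x xk; rewrite (le_trans (Sr x)) // ler_wpM2l // ltW.
  - move=> x.
    have [r r0 Hr] := strong_increment (C0_id S_C0) (C0_strong S_C0 (x := x)) ltr01.
    pose N := (Num.truncn r^-1).+1.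
    exists (1 + `|x| + \sum_(i < N) `|S (t i) x|) => _ [n ->].
    have [nN|Nn] := ltnP n N.
      rewrite (bigD1 (Ordinal nN)) //= addrCA lerDl addr_ge0 //.
      by rewrite sumr_ge0.
    apply: ler_wpDr; first by rewrite sumr_ge0.
    rewrite -(subrK x (S _ x)) (le_trans (ler_normD _ _)) // lerD2r.
    apply: Hr; have [/andP[-> tn] _] := Ht n; apply: le_lt_trans tn _.
    rewrite invf_plt ?posrE // (lt_le_trans (truncnS_gt _)) // ler_nat.
    by rewrite (leq_trans Nn).
  move=> C HC.
  have C0 : 0 <= C by have := HC (S (t 0)) _ 0; rewrite linear0 normr0; apply; [exists 0%N|].
  have [_ [x]] := Ht (Num.truncn C).+1.
  apply/negP; rewrite -leNgt.
  have [->|x0] := eqVneq x 0; first by rewrite linear0 normr0 mulr0.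
  have nx : 0 < `|x| by rewrite normr_gt0.
  have := HC (S (t (Num.truncn C).+1)) _ (`|x|^-1 *: x).
  rewrite normrZ normfV normr_id mulVf ?gt_eqF // lexx => /(_ _ isT).
  rewrite linearZ normrZ normfV normr_id mulrC ler_pdivrMr // => h.
  apply: le_trans (h _) _; first by eexists.
  by rewrite ler_wpM2r // ltW // truncnS_gt.
pose tau : R := n0.+1%:R^-1.
have tau0 : 0 < tau by rewrite invr_gt0.
pose M := Num.max 1 C.
have M1 : 1 <= M by rewrite le_max lexx.
have {}HC (t : R) x : 0 <= t <= tau -> `|S t x| <= M * `|x|.
  by move=> /HC/le_trans; apply; rewrite ler_wpM2r // le_max lexx orbT.
have HM n : forall (t : R) x, 0 <= t <= n%:R * tau -> `|S t x| <= M ^+ n * `|x|.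
  elim: n => [t x|n IH t x].
    rewrite mul0r => /andP[t0 t0']; have -> : t = 0 by apply/eqP; rewrite eq_le t0'.
    by rewrite (C0_id S_C0) expr0 mul1r.
  rewrite -natr1 mulrDl mul1r => /andP[t0 tn].
  have [tt|tt] := leP t tau.
    apply: le_trans (HC t x _) _; first by rewrite t0.
    by rewrite ler_wpM2r // exprS ler_peMr ?(le_trans ler01) // exprn_ege1.
  have -> : t = tau + (t - tau) by rewrite addrC subrK.
  have tt0 : 0 <= t - tau by rewrite subr_ge0 ltW.
  rewrite (C0_morph S_C0 (ltW tau0) tt0).
  apply: le_trans (HC _ _ _) _; first by rewrite lexx ltW.
  rewrite exprS -mulrA ler_wpM2l ?(le_trans ler01) //.
  by apply: IH; rewrite tt0 lerBlDr.
pose n := (Num.truncn (T / tau)).+1.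
exists (M ^+ n); first by rewrite exprn_ege1.
move=> t x /andP[t0 tT]; apply: HM; rewrite t0 /= (le_trans tT) //.
by rewrite -ler_pdivrMr // ltW // truncnS_gt.
Qed.

(** * The space of square integrable functions *)

Section L2_norm.
Context d (T : measurableType d) (R : realType).
Context (mu : {measure set T -> \bar R}) (p1 : (1 <= 2%:E :> \bar R)%E).
Local Notation H := (LspaceType mu p1).

Lemma L2_norm_sqr (f : H) :
  ((`|f| ^+ 2)%:E = \int[mu]_x ((Lrepr f x) ^+ 2)%:E)%E.
Proof.
have fin : ('N[mu]_2%:E[EFin \o Lrepr f] < +oo)%E.
  by have := Lrepr_Lfun f; rewrite inE => /andP[_]; rewrite inE.
rewrite Lspace_normE -powR_mulrn ?fine_ge0 ?Lnorm_ge0 // -poweR_EFin fineK; last first.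
  by rewrite ge0_fin_numE ?Lnorm_ge0.
rewrite poweR_Lnorm //; apply: eq_integral => x _ /=.
by rewrite powR_mulrn // real_normK ?num_real.
Qed.

Lemma Lfun2P (f : T -> R) : measurable_fun setT f ->
  (\int[mu]_x (f x ^+ 2)%:E < +oo)%E -> f \in Lfun mu 2%:E.
Proof.
move=> mf ifoo; rewrite inE; apply/andP; split; rewrite inE //=.
rewrite /finite_norm unlock /Lnorm poweR_lty //.
rewrite (eq_integral (fun x => (f x ^+ 2)%:E)) // => x _ /=.
by rewrite powR_mulrn // real_normK ?num_real.
Qed.

(** The Riesz-Fischer argument.  As the increments have norms at most [4 ^- n],
    their squares multiplied by [4 ^ n] have a finite integrated sum, so almost
    everywhere the increments are [O(2 ^- n)] and the representatives converge
    pointwise; Fatou's lemma carries the estimates over to the limit. *)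
Lemma L2_seq_cvg (u : nat -> H) :
  (forall n m, (n <= m)%N -> `|u m - u n| <= 4^-1 ^+ n) ->
  exists f : H, forall n, `|f - u n| <= 4^-1 ^+ n.
Proof.
move=> uC.
have mLrepr (g : H) : measurable_fun setT (Lrepr g) by exact: Lrepr_meas.
pose a n x := Lrepr (u n) x.
have diff m n : (\int[mu]_x ((a m x - a n x) ^+ 2)%:E = (`|u m - u n| ^+ 2)%:E)%E.
  rewrite L2_norm_sqr; apply: ge0_ae_eq_integral => //.
  - by apply/measurable_EFinP/measurable_funX/measurable_funB; exact: mLrepr.
  - by apply/measurable_EFinP/measurable_funX.
  - by move=> x _; rewrite lee_fin sqr_ge0.
  - by move=> x _; rewrite lee_fin sqr_ge0.
  have := LreprD (u m) (- u n); have := LreprN (u n).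
  by apply: filterS2 => x /= /(_ I) H1 /(_ I) H2 _; rewrite H2 /= H1.
pose b n x := (4 ^+ n * (a n.+1 x - a n x) ^+ 2)%:E.
have mb n : measurable_fun setT (b n).
  apply/measurable_EFinP/measurable_funM => //.
  by apply/measurable_funX/measurable_funB; exact: mLrepr.
have b0 n x : (0 <= b n x)%E by rewrite lee_fin mulr_ge0 ?sqr_ge0 // exprn_ge0.
have ib n : (\int[mu]_x b n x <= (2 / 2 ^+ n.+1)%:E)%E.
  under eq_integral do rewrite /b EFinM.
  rewrite ge0_integralZl //; last first.
  - by move=> x _; rewrite lee_fin sqr_ge0.
  - by apply/measurable_EFinP/measurable_funX/measurable_funB; exact: mLrepr.
  rewrite diff -EFinM lee_fin.
  have h : `|u n.+1 - u n| ^+ 2 <= (4^-1 ^+ n) ^+ 2.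
    by rewrite ler_pXn2r ?nnegrE ?exprn_ge0 // uC.
  apply: (@le_trans _ _ (4 ^+ n * (4^-1 ^+ n) ^+ 2)).
    by rewrite ler_wpM2l // exprn_ge0.
  rewrite expr2 mulrA -exprMn divff // expr1n mul1r exprS invfM mulrA divff // mul1r.
  by rewrite -exprVn lerXn2r ?nnegrE // lef_pV2 ?posrE // ler_nat.
have sumb : (\int[mu]_x \sum_(0 <= n <oo) b n x < +oo)%E.
  rewrite integral_nneseries //.
  apply: (@le_lt_trans _ _ 2%:E); last exact: ltry.
  apply: le_trans (epsilon_trick0 xpredT (ler0n R 2)).
  apply: lee_nneseries => n *; first by apply: integral_ge0 => x _; exact: b0.
  by rewrite natrX; exact: ib.
have [B [mB B0 Bfin]] : {ae mu, forall x, (\sum_(0 <= n <oo) b n x < +oo)%E}.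
  have : mu.-integrable setT (fun x => \sum_(0 <= n <oo) b n x)%E.
    apply/integrableP; split.
      by apply: ge0_emeasurable_sum.
    rewrite (eq_integral (fun x => \sum_(0 <= n <oo) b n x)%E) // => x _.
    by rewrite gee0_abs // nneseries_ge0.
  move=> /(integrable_ae measurableT); apply: filterS => x /(_ I).
  by rewrite ge0_fin_numE // nneseries_ge0.
have aeB : {ae mu, forall x, ~ B x} by exists B; split => // x /= /contrapT.
(* Cutting off the null set [B] makes the sequence converge everywhere, which
   keeps the limit measurable. *)
pose f n x := if x \in B then 0 else a n x.
have mf n : measurable_fun setT (f n).
  rewrite (_ : f n = \1_(~` B) \* a n).
    apply: measurable_funM; last exact: mLrepr.
    by apply: measurable_indic; exact: measurableC.
  by apply/funext => x; rewrite /f /= indicE in_setC; case: ifP; rewrite ?mul0r ?mul1r.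
have cvgf x : cvgn (f ^~ x).
  have [xB|xB] := boolP (x \in B).
    have -> : f ^~ x = cst 0 by apply/funext => n; rewrite /f xB.
    by apply/cvg_ex; exists 0; exact: cvg_cst.
  have -> : f ^~ x = a ^~ x by apply/funext => n; rewrite /f (negbTE xB).
  have {}xB : (\sum_(0 <= n <oo) b n x < +oo)%E.
    by apply: contrapT => xoo; move/negP : xB; apply; rewrite inE; exact: Bfin.
  pose C := fine (\sum_(0 <= n <oo) b n x)%E.
  have bC n : 4 ^+ n * (a n.+1 x - a n x) ^+ 2 <= C.
    rewrite -lee_fin fineK ?ge0_fin_numE ?nneseries_ge0 //.
    apply: le_trans (nneseries_lim_ge n.+1 _) => //.
    by rewrite big_nat_recr //= leeDr // sume_ge0.
  have C0 : 0 <= C by apply: le_trans (bC 0%N); rewrite mulr_ge0 ?sqr_ge0.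
  rewrite (_ : a^~ x = cst (a 0%N x) \+ series (telescope (a ^~ x))); last first.
    by apply/funext => n; rewrite /= -eq_sum_telescope.
  apply: is_cvgD; first by apply/cvg_ex; exists (a 0%N x); exact: cvg_cst.
  apply: normed_cvg.
  apply: (@series_le_cvg _ _ (geometric (Num.sqrt C) 2^-1)) => //.
  - by move=> n; exact: normr_ge0.
  - by move=> n; apply: mulr_ge0; rewrite ?sqrtr_ge0 ?exprn_ge0.
  - move=> n; rewrite /telescope /geometric /=.
    rewrite -(@ler_pXn2r _ 2) ?nnegrE ?mulr_ge0 ?sqrtr_ge0 ?exprn_ge0 //.
    rewrite real_normK ?num_real // exprMn sqr_sqrtr // -exprM mulnC exprM.
    have -> : (2^-1 : R) ^+ 2 = 4^-1 by rewrite exprVn -natrX.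
    by rewrite exprVn ler_pdivlMr ?exprn_gt0 // mulrC.
  - by apply: is_cvg_geometric_series; rewrite ger0_norm // invf_lt1 // ltr1n.
pose g x := limn (f ^~ x).
have mg : measurable_fun setT g.
  by apply: (measurable_fun_cvg mf) => x _; exact: cvgf.
have key n : (\int[mu]_x ((g x - a n x) ^+ 2)%:E <= ((4^-1 ^+ n) ^+ 2)%:E)%E.
  pose h m x := ((f m x - f n x) ^+ 2)%:E.
  have mh m : measurable_fun setT (h m).
    by apply/measurable_EFinP/measurable_funX/measurable_funB.
  have h0 m x : setT x -> (0 <= h m x)%E by rewrite lee_fin sqr_ge0.
  have ih m : (\int[mu]_x h m x = (`|u m - u n| ^+ 2)%:E)%E.
    rewrite -diff; apply: ge0_ae_eq_integral => //.
    - by apply/measurable_EFinP/measurable_funX/measurable_funB; exact: mLrepr.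
    - by move=> x _; rewrite lee_fin sqr_ge0.
    - by move=> x _; rewrite lee_fin sqr_ge0.
    by apply: filterS aeB => x xB _; rewrite ?/h /f !memNset.
  have -> : (\int[mu]_x ((g x - a n x) ^+ 2)%:E = \int[mu]_x ((g x - f n x) ^+ 2)%:E)%E.
    apply: ge0_ae_eq_integral => //.
    - by apply/measurable_EFinP/measurable_funX/measurable_funB => //; exact: mLrepr.
    - by apply/measurable_EFinP/measurable_funX/measurable_funB.
    - by move=> x _; rewrite lee_fin sqr_ge0.
    - by move=> x _; rewrite lee_fin sqr_ge0.
    by apply: filterS aeB => x xB _; rewrite ?/h /f !memNset.
  have -> : (\int[mu]_x ((g x - f n x) ^+ 2)%:E = \int[mu]_x limn_einf (h ^~ x))%E.
    apply: eq_integral => x _.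
    have : h ^~ x @ \oo --> ((g x - f n x) ^+ 2)%:E.
      apply: cvg_EFin; first exact: nearW.
      by apply: cvgM; apply: cvgB; [exact: cvgf|exact: cvg_cst|exact: cvgf|exact: cvg_cst].
    by move=> /cvg_limn_einf_sup[->].
  apply: le_trans (fatou mu measurableT mh h0) _.
  rewrite limn_einf_lim; apply: lime_le; first exact: is_cvg_einfs.
  apply: nearW => k; apply: (@le_trans _ _ (\int[mu]_x h (maxn k n) x)%E).
    by apply: ereal_inf_lbound; exists (maxn k n) => //=; rewrite leq_maxl.
  by rewrite ih lee_fin ler_pXn2r ?nnegrE ?exprn_ge0 // uC // leq_maxr.
have gL : g \in Lfun mu 2%:E.
  have : (g \- a 0%N) \in Lfun mu 2%:E.
    apply: Lfun2P; first by apply: measurable_funB => //; exact: mLrepr.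
    by apply: le_lt_trans (key 0%N) _; exact: ltry.
  move=> /(LfunD p1)/(_ (Lrepr_Lfun (u 0%N))).
  by rewrite (_ : (_ \+ _) = g) //; apply/funext => x /=; rewrite subrK.
exists (Lclass p1 gL) => n.
rewrite -(@ler_pXn2r _ 2) ?nnegrE ?exprn_ge0 // -lee_fin.
rewrite L2_norm_sqr; apply: le_trans (key n); rewrite le_eqVlt; apply/orP; left; apply/eqP.
apply: ge0_ae_eq_integral => //.
- by apply/measurable_EFinP/measurable_funX.
- by apply/measurable_EFinP/measurable_funX/measurable_funB => //; exact: mLrepr.
- by move=> x _; rewrite lee_fin sqr_ge0.
- by move=> x _; rewrite lee_fin sqr_ge0.
have := LreprD (Lclass p1 gL) (- u n); have := LreprN (u n); have := LreprE p1 gL.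
by apply: filterS3 => x /= /(_ I) H1 /(_ I) H2 /(_ I) H3 _; rewrite H3 /= H1 H2.
Qed.
End L2_norm.

Section L2_complete.
Context d (T : measurableType d) (R : realType).
Context (mu : {measure set T -> \bar R}) (p1 : (1 <= 2%:E :> \bar R)%E).
Local Notation H := (LspaceType mu p1).

(** A Cauchy filter contains balls of radius [4 ^- n / 2]; their centers form a
    fast Cauchy sequence, whose limit is that of the filter. *)
Lemma L2_complete (F : set_system H) : ProperFilter F -> cauchy F -> cvg F.
Proof.
move=> FF /(cauchyP (R := R)) Fc.
pose r n : R := 4^-1 ^+ n / 2.
have r0 n : 0 < r n by rewrite divr_gt0 // exprn_gt0.
have rle m n : (n <= m)%N -> r m <= r n.
  by move=> nm; rewrite ler_pM2r // ler_wiXn2l // invf_le1 // ler1n.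
have /choice[u Fu] : forall n, exists x : H, F (ball x (r n)).
  by move=> n; exact: Fc.
have [n m nm|f fu] := @L2_seq_cvg _ _ _ mu p1 u.
  have [z [/= zm zn]] := filter_ex (filterI (Fu m) (Fu n)).
  move: zm zn; rewrite -ball_normE /= => zm zn.
  rewrite -(subrKA z) (le_trans (ler_normD _ _)) // (splitr (4^-1 ^+ n)).
  rewrite lerD //; first by rewrite (le_trans (ltW zm)) // rle.
  by rewrite distrC ltW.
apply/cvg_ex; exists f; apply/cvg_ballP => e e0.
have [n ne] : exists n, 4^-1 ^+ n * 2 < e.
  have : geometric 2 (4^-1 : R) @ \oo --> 0.
    by apply: cvg_geometric; rewrite ger0_norm // invf_lt1 // ltr1n.
  move=> /cvgrPdist_lt/(_ _ e0)[n _ /(_ n (leqnn n))] h.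
  exists n; move: h; rewrite /= sub0r normrN ger0_norm.
    by rewrite mulrC.
  by rewrite mulr_ge0 // exprn_ge0.
apply: filterS (Fu n) => z; rewrite -!ball_normE /= => uz.
apply: le_lt_trans ne; rewrite -(subrKA (u n)) (le_trans (ler_normD _ _)) //.
apply: (@le_trans _ _ (4^-1 ^+ n + 4^-1 ^+ n)); last by rewrite mulr_natr mulr2n.
rewrite lerD //.
by rewrite (le_trans (ltW uz)) // /r ler_pdivrMr // ler_peMr ?exprn_ge0 // ler1n.
Qed.
End L2_complete.

Lemma L2_semigroup_bound (R : realType) (d : nat)
    (S : R -> {linear L2 R d -> L2 R d}) (T : R) : C0_semigroup S ->
  exists2 M : R, 1 <= M &
    forall (t : R) (x : L2 R d), 0 <= t <= T -> `|S t x| <= M * `|x|.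
Proof.
move=> S_C0.
pose L := LspaceType (lebesgue_rV R d) (lee1n 2).
pose E : completeNormedModType R := HB.pack L
  (Uniform_isComplete.Build L (@L2_complete _ _ R (lebesgue_rV R d) (lee1n 2))).
exact: (@semigroup_bound R E S T S_C0).
Qed.

(** * Lebesgue measure on the d-dimensional space *)

(** The image of Lebesgue measure under [z |-> c * (a - z)], multiplied by [c],
    agrees with Lebesgue measure on intervals. *)
Lemma lebesgue_reflect_scale (R : realType) (c a : R) (f : R -> \bar R) : 0 < c ->
  measurable_fun [set: measurableTypeR R] f -> (forall x, (0 <= f x)%E) ->
  (\int[@lebesgue_measure R]_z f (c * (a - z))%R =
   (c^-1)%:E * \int[@lebesgue_measure R]_z f z)%E.
Proof.
move=> c0 mf f0.
pose h := (fun z => c * (a - z)) : measurableTypeR R -> measurableTypeR R.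
have mh : measurable_fun setT h.
  by apply: measurable_funM => //; apply: measurable_funB.
have c0' : 0 <= c by exact: ltW.
pose nu0 := mscale (NngNum c0') (pushforward (@lebesgue_measure R) h).
pose nu : {measure set (measurableTypeR R) -> \bar R} := nu0 mh.
have nuE (X : set (measurableTypeR R)) : measurable X ->
    lebesgue_measure X = nu X.
  apply: lebesgue_measure_unique => _ [[p q] _ <-] /=.
  rewrite /nu /nu0 /mscale /= /pushforward.
  have -> : h @^-1` `]p, q]%classic = `[a - q / c, a - p / c[%classic.
    apply/seteqP; split=> z /=; rewrite !in_itv /= /h.
      move=> /andP[pz zq]; apply/andP; split.
        by rewrite lerBlDr -lerBlDl ler_pdivlMr // mulrC.
      by rewrite ltrBrDr -ltrBrDl ltr_pdivrMr // mulrC.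
    move=> /andP[qz zp]; apply/andP; split.
      by rewrite mulrC -ltr_pdivrMr // ltrBrDl -ltrBrDr.
    by rewrite mulrC -ler_pdivlMr // lerBlDl -lerBlDr.
  have := lebesgue_measure_itv `[a - q / c, a - p / c[; rewrite /= => ->.
  have := lebesgue_measure_itv `]p, q]; rewrite /= => ->.
  rewrite !lte_fin ltrD2l ltrN2 ltr_pM2r ?invr_gt0 //.
  case: ifPn => _; last by rewrite mule0.
  rewrite -!EFinB -EFinM; congr EFin; field; exact: lt0r_neq0.
rewrite [in RHS](eq_measure_integral nu); last first.
  by move=> X mX _; exact: nuE.
rewrite /nu /nu0 ge0_integral_mscale // ge0_integral_pushforward //.
by rewrite muleA -EFinM mulVf ?gt_eqF // mul1e preimage_setT.
Qed.

Lemma integral_rVS (R : realType) n (f : 'rV[R]_n.+1 -> \bar R) :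
  measurable_fun setT f -> (forall x, (0 <= f x)%E) ->
  (\int[lebesgue_rV R n.+1]_v f v =
   \int[@lebesgue_measure R]_z \int[lebesgue_rV R n]_y f (rV_cons (z, y)))%E.
Proof.
move=> mf f0.
rewrite /= /leb_step ge0_integral_pushforward //; last exact: measurable_rV_cons.
rewrite preimage_setT fubini_tonelli1 //; last by move=> z; exact: f0.
by apply: measurableT_comp => //; exact: measurable_rV_cons.
Qed.

(** By Tonelli's theorem the first coordinate and the others can be treated
    separately. *)
Lemma lebesgue_rV_reflect_scale (R : realType) (n : nat) (c : R) (x : 'rV[R]_n)
    (f : 'rV[R]_n -> \bar R) : 0 < c ->
  measurable_fun setT f -> (forall x, (0 <= f x)%E) ->
  (\int[lebesgue_rV R n]_y f (c *: (x - y))%R =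
   (c ^- n)%:E * \int[lebesgue_rV R n]_y f y)%E.
Proof.
move=> c0; elim: n x f => [x f mf f0|n IH x f mf f0].
  rewrite expr0 invr1 mul1e; apply: eq_integral => y _.
  by congr f; rewrite !thinmx0.
have mxy k (v : 'rV[R]_k) : measurable_fun setT (fun y : 'rV[R]_k => c *: (v - y)).
  apply: measurable_fun_coordP => i.
  rewrite (_ : (fun _ => _) = (fun y : 'rV[R]_k => c * (v ord0 i - y ord0 i))).
    by apply: measurable_funM => //; apply: measurable_funB => //; exact: measurable_coord.
  by apply/funext => y; rewrite !mxE.
have mfx : measurable_fun setT (fun y : 'rV[R]_n.+1 => f (c *: (x - y))).
  exact: measurableT_comp mf (mxy _ x).
rewrite (integral_rVS mfx) // (integral_rVS mf) //.
pose x' : 'rV[R]_n := \row_j x ord0 (lift ord0 j).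
pose F z := (\int[lebesgue_rV R n]_y f (rV_cons (z, y)))%E.
have mfc : measurable_fun setT (f \o @rV_cons R n).
  by apply: measurableT_comp => //; exact: measurable_rV_cons.
have mF : measurable_fun [set: measurableTypeR R] F.
  apply: (@measurable_fun_fubini_tonelli_F _ _ _ _ R (lebesgue_rV R n)
    (f \o @rV_cons R n)) => // z.
  exact: f0.
have F0 z : (0 <= F z)%E by exact: integral_ge0.
transitivity (\int[@lebesgue_measure R]_z
    ((c ^- n)%:E * F (c * (x ord0 ord0 - z))%R))%E.
  apply: eq_integral => z _; rewrite /F -(IH x') //; last first.
    exact: (measurableT_comp mfc (pair1_measurable _)).
  apply: eq_integral => y _; congr f; apply/rowP => i.
  have [->|[j ->]] : i = ord0 \/ exists j, i = lift ord0 j.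
    by case: (unliftP ord0 i) => [j ->|->]; [right; exists j|left].
    by rewrite mxE mxE mxE !rV_uncons_head.
  by rewrite mxE mxE mxE !rV_uncons_tail /= !mxE.
have mFc : measurable_fun [set: measurableTypeR R] (fun z => F (c * (x ord0 ord0 - z))).
  apply: (measurableT_comp mF); apply: measurable_funM; first exact: measurable_cst.
  by apply: measurable_funB; [exact: measurable_cst|exact: measurable_id].
have cn0 : (0 <= (c ^- n)%:E)%E by rewrite lee_fin invr_ge0 exprn_ge0 // ltW.
rewrite (ge0_integralZl _ measurableT mFc (fun z _ => F0 _) cn0).
rewrite (lebesgue_reflect_scale _ c0 mF F0) muleA -EFinM; congr (_%:E * _)%E.
by rewrite exprS invfM mulrC.
Qed.

(** [f] is the pointwise limit of its compositions with the roundings down of the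
    coordinates to multiples of [1 / k.+1]; these factor through the countable
    type of integer vectors. *)
Lemma continuous_rV_measurable (R : realType) n (f : 'rV[R]_n -> R) :
  continuous f -> measurable_fun [set: 'rV[R]_n] f.
Proof.
move=> cf.
pose fl k (x : 'rV[R]_n) : 'rV[int]_n := \row_j Num.floor (k.+1%:R * x ord0 j).
pose gr k (z : 'rV[int]_n) : 'rV[R]_n := \row_j ((z ord0 j)%:~R / k.+1%:R).
apply: (measurable_fun_cvg (h := fun k => f \o gr k \o fl k)) => [k|x _].
  move=> _ Y mY; rewrite setTI.
  have -> : (f \o gr k \o fl k) @^-1` Y =
      \bigcup_(z in [set z | Y (f (gr k z))]) fl k @^-1` [set z].
    apply/seteqP; split=> [x Yx|x [z Yz /= xz]]; first by exists (fl k x).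
    by rewrite /preimage /= xz.
  rewrite bigcup_mkcond; apply: countable_bigcupT_measurable => // z.
  case: ifP => // _.
  have -> : fl k @^-1` [set z] = \bigcap_(j in [set: 'I_n])
      ((fun x : 'rV[R]_n => x ord0 j) @^-1` [set t | Num.floor (k.+1%:R * t) = z ord0 j]).
    apply/seteqP; split=> [x /= <- j _ /=|x xz]; first by rewrite mxE.
    by apply/rowP => j; rewrite mxE; exact: xz.
  apply: fin_bigcap_measurable => // j _.
  rewrite -[X in measurable X]setTI; apply: measurable_coord => //.
  have -> : [set t : R | Num.floor (k.+1%:R * t) = z ord0 j] =
      `[(z ord0 j)%:~R / k.+1%:R, (z ord0 j + 1)%:~R / k.+1%:R[%classic.
    apply/seteqP; split=> t /=; rewrite in_itv /=.
      move=> <-; rewrite ler_pdivrMr // ltr_pdivlMr // mulrC.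
      exact: floor_itv.
    rewrite ler_pdivrMr // ltr_pdivlMr // mulrC => zt.
    exact/floor_def.
  exact: measurable_itv.
apply: cvg_comp; last exact: cf.
apply/cvgrPdist_le => e e0; near=> k.
rewrite [leLHS]mx_normrE; apply: bigmax_le => [|[i j] _]; first exact: ltW.
rewrite !mxE /= (ord1 i); set t := x ord0 j.
have k0 : (0 : R) < k.+1%:R by [].
have /andP[lt1 lt2] := floor_itv (k.+1%:R * t).
have -> : t - (Num.floor (k.+1%:R * t))%:~R / k.+1%:R =
    (k.+1%:R * t - (Num.floor (k.+1%:R * t))%:~R) / k.+1%:R.
  by rewrite mulrBl mulrAC divff ?mul1r // gt_eqF.
rewrite ger0_norm; last by rewrite divr_ge0 // subr_ge0.
apply: (@le_trans _ _ k.+1%:R^-1); last first.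
  near: k; have [N _ HN] := near_infty_natSinv_lt (PosNum e0).
  by exists N => // k Nk; apply/ltW/HN.
rewrite ler_pdivrMr // mulVf ?gt_eqF // lerBlDr (le_trans (ltW lt2)) //.
by rewrite intrD addrC.
Unshelve. all: by end_near. Qed.

(** * Regularization of the potential *)

(** The essential supremum is the bound, unless the measure is zero, in which case
    the norm is [0] by convention and there is nothing to bound. *)
Lemma Lfun_infty_ae_bounded d (T : measurableType d) (R : realType)
    (mu : {measure set T -> \bar R}) (q : T -> R) : q \in Lfun mu +oo ->
  measurable_fun setT q /\ exists2 Q : R, 0 <= Q & {ae mu, forall x, `|q x| <= Q}.
Proof.
rewrite inE => /andP[]; rewrite !inE /= => mq qoo; split => //.
move: qoo; rewrite /finite_norm unlock /Lnorm; case: ifPn => [mu0 qoo|mu0 _].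
  set s := ess_sup _ _ in qoo.
  have s0 : (0 <= s)%E by apply: ess_sup_gee => //; apply: aeW => x; exact: abse_ge0.
  exists (fine s); first exact: fine_ge0.
  apply: filterS (ess_sup_ge mu (abse \o (EFin \o q))) => x qx.
  by rewrite -lee_fin fineK // ge0_fin_numE.
exists 0 => //; exists setT; split => //.
by apply/eqP; rewrite eq_le measure_ge0 andbT leNgt.
Qed.

(** Only the values of [q] where [k] does not vanish matter.  With [a] a value of
    [q] this expresses that [k] is concentrated where [q] is close to [a]; with
    [a = 0] it bounds the mean by a bound of [q]. *)
Lemma weighted_mean_dist d (T : measurableType d) (R : realType)
    (mu : {measure set T -> \bar R}) (q k : T -> R) (a e : R) :
  measurable_fun setT q -> measurable_fun setT k -> (forall y, 0 <= k y) ->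
  (\int[mu]_y (k y)%:E = 1)%E -> 0 <= e ->
  {ae mu, forall y, k y != 0 -> `|q y - a| <= e} ->
  `|\int[mu]_y (q y * k y) - a| <= e.
Proof.
move=> mq mk k0 k1 e0 qa.
pose h y := (q y - a) * k y.
have mh : measurable_fun setT h.
  by apply: measurable_funM => //; apply: measurable_funB.
have mEh : measurable_fun setT (EFin \o h) by exact/measurable_EFinP.
have ik : mu.-integrable setT (EFin \o k).
  apply/integrableP; split; first exact/measurable_EFinP.
  rewrite (eq_integral (fun y => (k y)%:E)) ?k1 ?ltry // => y _ /=.
  by rewrite ger0_norm.
have ihe : (\int[mu]_y `|(h y)%:E| <= e%:E)%E.
  rewrite -[e%:E]mule1 -k1 -ge0_integralZl //; last 2 first.
  - exact/measurable_EFinP.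
  - by move=> y _; rewrite lee_fin.
  apply: ae_ge0_le_integral => //.
  - by apply: measurableT_comp => //; exact: mEh.
  - by move=> y _; rewrite mule_ge0 ?lee_fin.
  - by apply: measurable_funeM; exact/measurable_EFinP.
  apply: filterS qa => y qy _; rewrite /h /= -EFinM lee_fin normrM (ger0_norm (k0 y)).
  have [->|ky] := eqVneq (k y) 0; first by rewrite !mulr0.
  by rewrite ler_wpM2r // qy.
have ih : mu.-integrable setT (EFin \o h).
  apply/integrableP; split; first exact/measurable_EFinP.
  by apply: le_lt_trans ihe _; rewrite ltry.
have -> : \int[mu]_y (q y * k y) - a = \int[mu]_y h y.
  have -> : (fun y => q y * k y) = (fun y => h y + a * k y).
    by apply/funext => y; rewrite /h mulrBl subrK.
  have iak : mu.-integrable setT (EFin \o (fun y => a * k y)).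
    rewrite (_ : _ \o _ = (fun y => a%:E * (EFin \o k) y)%E) //.
    exact: integrableZl.
  rewrite RintegralD //.
  rewrite RintegralZl // /Rintegral k1 /= mulr1; by rewrite addrK.
rewrite -lee_fin; apply: le_trans ihe.
have ihf : (\int[mu]_y (h y)%:E)%E \is a fin_num by exact: integrable_fin_num.
rewrite /Rintegral -abse_EFin fineK //.
by apply: le_abse_integral => //; exact/measurable_EFinP.
Qed.

Section regularization.
Context (R : realType) (d : nat).
Local Notation mu := (lebesgue_rV R d).
Variables (q phi : 'rV[R]_d -> R) (l : R -> R).
Hypothesis mq : measurable_fun setT q.
Hypothesis mol : mollifier phi.

Let mphi : measurable_fun setT phi.
Proof. by apply: continuous_rV_measurable; case: (mollifier_smooth mol [::]). Qed.

Let mphi_reflect_scale (c : R) x :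
  measurable_fun setT (fun y : 'rV[R]_d => phi (c *: (x - y))).
Proof.
apply: (measurableT_comp mphi); apply: measurable_fun_coordP => i.
rewrite (_ : (fun _ => _) = (fun y : 'rV[R]_d => c * (x ord0 i - y ord0 i))).
  by apply: measurable_funM => //; apply: measurable_funB => //; exact: measurable_coord.
by apply/funext => y; rewrite !mxE.
Qed.

Lemma measurable_mollifying_net eps x :
  measurable_fun setT (fun y : 'rV[R]_d => mollifying_net phi l eps (x - y)).
Proof. by apply: measurable_funM => //; exact: mphi_reflect_scale. Qed.

Lemma integral_mollifying_net eps x : 0 < l eps ->
  (\int[mu]_y (mollifying_net phi l eps (x - y)%R)%:E = 1)%E.
Proof.
move=> le0.
have phi0 z : (0 <= (phi z)%:E)%E by rewrite lee_fin (mollifier_ge0 mol).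
have := @lebesgue_rV_reflect_scale R d (l eps)^-1 x (EFin \o phi).
rewrite invr_gt0 le0 => /(_ isT)/=.
rewrite (mollifier_int1 mol) mule1 => H.
rewrite /mollifying_net; under eq_integral do rewrite EFinM.
have c0 : (0 <= ((l eps) ^- d)%:E)%E by rewrite lee_fin invr_ge0 exprn_ge0 // ltW.
have mE : measurable_fun setT (fun y : 'rV[R]_d => (phi ((l eps)^-1 *: (x - y)))%:E).
  by apply/measurable_EFinP; exact: mphi_reflect_scale.
rewrite (ge0_integralZl _ measurableT mE (fun y _ => phi0 _) c0) H //; last first.
  exact/measurable_EFinP.
by rewrite -EFinM exprVn invrK mulVf // expf_neq0 // gt_eqF.
Qed.

Lemma regularizing_net_dist eps x a e : 0 < l eps -> 0 <= e ->
  {ae mu, forall y, mollifying_net phi l eps (x - y) != 0 -> `|q y - a| <= e} ->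
  `|regularizing_net q phi l eps x - a| <= e.
Proof.
move=> le0 e0 qa; apply: weighted_mean_dist => //.
- exact: measurable_mollifying_net.
- move=> y; rewrite /mollifying_net mulr_ge0 ?(mollifier_ge0 mol) //.
  by rewrite invr_ge0 exprn_ge0 // ltW.
exact: integral_mollifying_net.
Qed.

Lemma regularizing_net_le Q eps x : 0 < l eps -> 0 <= Q ->
  {ae mu, forall y, `|q y| <= Q} -> `|regularizing_net q phi l eps x| <= Q.
Proof.
move=> le0 Q0 qQ; rewrite -[X in `|X|]subr0; apply: regularizing_net_dist => //.
by apply: filterS qQ => y qy _; rewrite subr0.
Qed.

Lemma regularizing_net_cvg x : {for x, continuous q} ->
  (forall eps, 0 < eps <= 1 -> 0 < l eps) -> l eps @[eps --> 0^'+] --> 0 ->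
  regularizing_net q phi l eps x @[eps --> 0^'+] --> q x.
Proof.
move=> cq l0 lcvg; apply/cvgrPdist_le => e e0.
have [K K0 HK] : exists2 K, 0 < K & forall z, phi z != 0 -> `|z| <= K.
  have := compact_bounded (mollifier_support mol).
  move=> /pinfty_ex_gt0[K K0 HK]; exists K => // z pz; apply: HK.
  exact: subset_closure.
have /cvgrPdist_le/(_ _ e0)/nbhs_ballP[rho /= rho0 Hrho] := cq.
have rK : 0 < rho / (2 * K) by rewrite divr_gt0 // mulr_gt0.
near=> eps.
have le0 : 0 < l eps.
  by apply: l0; apply/andP; split; near: eps; [exact: nbhs_right_gt|exact: nbhs_right_le].
rewrite distrC; apply: regularizing_net_dist => //; first exact: ltW.
apply: aeW => y; rewrite /mollifying_net mulf_eq0 negb_or => /andP[_ /HK].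
rewrite normrZ gtr0_norm ?invr_gt0 // ler_pdivrMl // => xy.
rewrite distrC; apply: Hrho; rewrite -ball_normE /=.
apply: le_lt_trans xy _; rewrite -ltr_pdivlMr //.
have : `|0 - l eps| < rho / (2 * K).
  by near: eps; move/cvgrPdist_lt : lcvg; apply.
rewrite sub0r normrN gtr0_norm // => /lt_le_trans; apply.
by rewrite ler_pM2l // lef_pV2 ?posrE ?mulr_gt0 // ler_peMl ?ler1n // ltW.
Unshelve. all: by end_near. Qed.
End regularization.

(** * Multiplication operators *)

Definition ae_bounded d (T : measurableType d) (R : realType)
    (mu : {measure set T -> \bar R}) (r : T -> R) (Q : R) : Prop :=
  measurable_fun setT r /\ {ae mu, forall x, `|r x| <= Q}.

Section multiplication_operator.
Context d (T : measurableType d) (R : realType).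
Context (mu : {measure set T -> \bar R}) (p1 : (1 <= 2%:E :> \bar R)%E).
Local Notation H := (LspaceType mu p1).
Implicit Types (r : T -> R) (u v : H) (Q : R).

Let integral_mul_le r u Q : ae_bounded mu r Q ->
  (\int[mu]_x ((r x * Lrepr u x) ^+ 2)%:E <= ((Q * `|u|) ^+ 2)%:E)%E.
Proof.
move=> [mr rQ]; have mLu := Lrepr_meas u.
rewrite exprMn EFinM L2_norm_sqr -ge0_integralZl //; last 3 first.
- by apply/measurable_EFinP/measurable_funX.
- by move=> x _; rewrite lee_fin sqr_ge0.
- by rewrite lee_fin sqr_ge0.
apply: ae_ge0_le_integral => //.
- by move=> x _; rewrite lee_fin sqr_ge0.
- by apply/measurable_EFinP/measurable_funX/measurable_funM.
- by move=> x _; rewrite mule_ge0 ?lee_fin ?sqr_ge0.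
- by apply: measurable_funeM; apply/measurable_EFinP/measurable_funX.
apply: filterS rQ => x rx _; rewrite -EFinM lee_fin exprMn ler_wpM2r ?sqr_ge0 //.
by rewrite -(real_normK (num_real (r x))) ler_pXn2r ?nnegrE // (le_trans _ rx).
Qed.

Lemma ae_boundedB r r' Q : ae_bounded mu r Q -> ae_bounded mu r' Q ->
  ae_bounded mu (r \- r') (Q + Q).
Proof.
move=> [mr rQ] [mr' r'Q]; split; first exact: measurable_funB.
by apply: filterS2 rQ r'Q => x rx r'x; rewrite (le_trans (ler_normB _ _)) // lerD.
Qed.

Lemma LmulE r u Q : ae_bounded mu r Q ->
  Lrepr (Lmul r u) = r \* Lrepr u %[ae mu].
Proof.
move=> rQ; rewrite /Lmul; case: pselect => [ruL|]; first exact: LreprE.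
case; apply: Lfun2P; first by apply: measurable_funM; [case: rQ|exact: Lrepr_meas].
by apply: le_lt_trans (integral_mul_le u rQ) _; rewrite ltry.
Qed.

Lemma Lmul_norm_sqr r u Q : ae_bounded mu r Q ->
  ((`|Lmul r u| ^+ 2)%:E = \int[mu]_x ((r x * Lrepr u x) ^+ 2)%:E)%E.
Proof.
move=> rQ; rewrite L2_norm_sqr; apply: ge0_ae_eq_integral => //.
- by apply/measurable_EFinP/measurable_funX; exact: Lrepr_meas.
- apply/measurable_EFinP/measurable_funX/measurable_funM; last exact: Lrepr_meas.
  by case: rQ.
- by move=> x _; rewrite lee_fin sqr_ge0.
- by move=> x _; rewrite lee_fin sqr_ge0.
by apply: filterS (LmulE u rQ) => x /(_ I) /= -> _.
Qed.

Lemma Lmul_le r u Q : 0 <= Q -> ae_bounded mu r Q -> `|Lmul r u| <= Q * `|u|.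
Proof.
move=> Q0 rQ; rewrite -(@ler_pXn2r _ 2) ?nnegrE ?mulr_ge0 // -lee_fin.
by rewrite (Lmul_norm_sqr u rQ) integral_mul_le.
Qed.

Lemma LmulB r u v Q : ae_bounded mu r Q -> Lmul r (u - v) = Lmul r u - Lmul r v.
Proof.
move=> rQ; apply: Lspace_ext.
have := LreprD (Lmul r u) (- Lmul r v); apply: filter_app.
have := LreprN (Lmul r v); apply: filter_app.
have := LreprD u (- v); apply: filter_app.
have := LreprN v; apply: filter_app.
have := LmulE v rQ; have := LmulE u rQ; have := LmulE (u - v) rQ.
apply: filterS3 => x /(_ I) H1 /(_ I) H2 /(_ I) H3 /(_ I) H4 /(_ I) H5 /(_ I) H6 /(_ I) H7 _.
by rewrite H7 /= H6 H1 /= H5 /= H4 H2 H3 /= mulrBr.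
Qed.

Lemma Lmul_subl r r' u Q : ae_bounded mu r Q -> ae_bounded mu r' Q ->
  Lmul (r \- r') u = Lmul r u - Lmul r' u.
Proof.
move=> rQ r'Q; have rr'Q := ae_boundedB rQ r'Q.
apply: Lspace_ext.
have := LreprD (Lmul r u) (- Lmul r' u); apply: filter_app.
have := LreprN (Lmul r' u); apply: filter_app.
have := LmulE u rQ; have := LmulE u r'Q; have := LmulE u rr'Q.
apply: filterS3 => x /(_ I) H1 /(_ I) H2 /(_ I) H3 /(_ I) H4 /(_ I) H5 _.
by rewrite H5 /= H4 H1 /= H2 H3 /= mulrBl.
Qed.

(** Dominated convergence is available for sequences.  The hypotheses on [r eps]
    are restricted to [eps <= 1], hence the truncation [e'] of the sequence of
    parameters, which changes finitely many terms. *)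
Lemma Lmul_cvg0 (r : R -> T -> R) u Q :
  (forall eps, 0 < eps <= 1 -> ae_bounded mu (r eps) Q) ->
  (forall x, r eps x @[eps --> 0^'+] --> 0) ->
  `|Lmul (r eps) u| @[eps --> 0^'+] --> 0.
Proof.
move=> rQ r0; apply/cvg_at_rightP => e [e0 ecvg].
pose e' n := Num.min (e n) 1.
have e'01 n : 0 < e' n <= 1 by rewrite lt_min e0 ltr01 ge_min lexx orbT.
have ee' : \forall n \near \oo, e' n = e n.
  have /cvgrPdist_lt/(_ _ ltr01) := ecvg.
  apply: filterS => n; rewrite sub0r normrN gtr0_norm // => en1.
  by rewrite /e'; apply/min_idPl/ltW.
have e'cvg : e' n @[n --> \oo] --> 0.
  apply: cvg_trans ecvg; apply: near_eq_cvg.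
  by apply: filterS ee' => n ->.
suff : (`|Lmul (r (e' n)) u| ^+ 2) @[n --> \oo] --> (0 : R).
  move=> /cvgrPdist_lt H; apply/cvgrPdist_lt => eps eps0.
  have := H (eps ^+ 2); rewrite exprn_gt0 // => /(_ isT); apply: filter_app.
  apply: filterS ee' => n ->; rewrite !sub0r !normrN ger0_norm ?sqr_ge0 // normr_id.
  by rewrite ltr_pXn2r ?nnegrE // ltW.
have mLu := Lrepr_meas u.
have e'0 n : 0 < e' n by case/andP: (e'01 n).
have := @dominated_convergence _ _ R mu setT measurableT
  (fun n x => ((r (e' n) x * Lrepr u x) ^+ 2)%:E) (fun=> 0%E)
  (fun x => ((Q * Lrepr u x) ^+ 2)%:E).
case.
- move=> n; apply/measurable_EFinP/measurable_funX/measurable_funM => //.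
  by case: (rQ _ (e'01 n)).
- exact: measurable_cst.
- apply: aeW => x _; apply: cvg_EFin; first exact: nearW.
  rewrite [X in _ --> X](_ : 0 = (0 * Lrepr u x) ^+ 2); last first.
    by rewrite mul0r expr0n.
  have h : r (e' n) x @[n --> \oo] --> 0.
    by have /cvg_at_rightP/(_ e') := r0 x; apply; split.
  by rewrite expr2; apply: cvgM; apply: cvgM => //; exact: cvg_cst.
- apply/integrableP; split; first by apply/measurable_EFinP/measurable_funX/measurable_funM.
  rewrite (eq_integral (fun x => (Q ^+ 2)%:E * ((Lrepr u x) ^+ 2)%:E)%E); last first.
    by move=> x _; rewrite /= ger0_norm ?sqr_ge0 // exprMn.
  rewrite ge0_integralZl //; last 3 first.
  + by apply/measurable_EFinP/measurable_funX.
  + by move=> x _; rewrite lee_fin sqr_ge0.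
  + by rewrite lee_fin sqr_ge0.
  by rewrite -L2_norm_sqr -EFinM ltry.
- apply/ae_foralln => n; apply: filterS (rQ _ (e'01 n)).2 => x rx _.
  rewrite /= lee_fin ger0_norm ?sqr_ge0 // !exprMn ler_wpM2r ?sqr_ge0 //.
  by rewrite -(real_normK (num_real (r _ x))) ler_pXn2r ?nnegrE // (le_trans _ rx).
move=> _ _; rewrite integral0 => H.
rewrite (_ : (fun n => _) = fine \o
    (fun n => \int[mu]_x ((r (e' n) x * Lrepr u x) ^+ 2)%:E)%E); last first.
  by apply/funext => n /=; rewrite -(Lmul_norm_sqr u (rQ _ (e'01 n))).
exact: (fine_cvg H).
Qed.

(** The operators are bounded by [Q] uniformly in [eps], so that the estimate at
    one time holds nearby, and [[0, S]] is compact. *)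
Lemma Lmul_cvg0_uniform (r : R -> T -> R) (v : R -> H) (S Q : R) (e : R) :
  0 <= Q -> 0 < e -> {within `[0, S], continuous v} ->
  (forall eps, 0 < eps <= 1 -> ae_bounded mu (r eps) Q) ->
  (forall x, r eps x @[eps --> 0^'+] --> 0) ->
  \forall eps \near 0^'+, forall t : R, 0 <= t <= S -> `|Lmul (r eps) (v t)| <= e.
Proof.
move=> Q0 e0 cv rQ r0.
have /compact_near_coveringP/near_covering_withinP cover := @segment_compact R 0 S.
have nx : forall x, x \in `[0, S] ->
   \forall x' \near x & i \near 0^'+, x' \in `[0, S] -> `|Lmul (r i) (v x')| <= e.
  move=> t tS.
  have e2 : 0 < e / 2 by rewrite divr_gt0.
  have eQ : 0 < e / 2 / (Q + 1) by rewrite divr_gt0 // ltr_wpDl.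
  have H1 : \forall x' \near t, x' \in `[0, S] -> `|v t - v x'| <= e / 2 / (Q + 1).
    move/subspace_continuousP : cv => /(_ t tS) /cvgrPdist_le/(_ _ eQ).
    by rewrite near_withinE.
  have H2 : \forall i \near 0^'+, 0 < i <= 1 /\ `|Lmul (r i) (v t)| <= e / 2.
    have /cvgrPdist_le/(_ _ e2) := Lmul_cvg0 (v t) rQ r0.
    apply: filter_app; near=> i; rewrite sub0r normrN normr_id; split => //.
    by apply/andP; split; near: i; [exact: nbhs_right_gt|exact: nbhs_right_le].
  near=> x' i => x'S.
  have [i01 iv] : 0 < i <= 1 /\ `|Lmul (r i) (v t)| <= e / 2.
    by near: i; exact: H2.
  have vx' : x' \in `[0, S] -> `|v t - v x'| <= e / 2 / (Q + 1) by near: x'; exact: H1.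
  rewrite -[v x'](subKr (v t)) (LmulB _ _ (rQ i i01)).
  rewrite (le_trans (ler_normB _ _)) // (splitr e) lerD //.
  apply: le_trans (Lmul_le _ Q0 (rQ i i01)) _.
  apply: (@le_trans _ _ ((Q + 1) * (e / 2 / (Q + 1)))).
    by rewrite ler_pM ?lerDl // vx'.
  by rewrite mulrC divfK // gt_eqF // ltr_wpDl.
have H := cover R (0^'+) (fun eps t => `|Lmul (r eps) (v t)| <= e) _ nx.
near=> eps => t tS.
have He : `[0, S]%classic `<=` (fun t => `|Lmul (r eps) (v t)| <= e) by near: eps; exact: H.
by apply: He; rewrite /= in_itv.
Unshelve. all: by end_near. Qed.

End multiplication_operator.

(** * Summation over multi-indices *)

(** Because of this, the norms with weight exponent [- p] decrease with [p]. *)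
Lemma weight_ge1 (R : realType) (g : multi_index) : 1 <= weight R g.
Proof.
rewrite /weight; elim/big_ind: _ => // [x y x1 y1|k _].
  by rewrite -[1]mulr1 ler_pM.
by rewrite exprn_ege1 // ler1n.
Qed.

(** All but a small part of the sum of [g] lies on a finite set of indices, where
    the terms [f e i] are eventually as small as desired. *)
Lemma esum_dominated_cvg0 (R : realType) (I : choiceType) (F : set_system R)
    (FF : Filter F) (f : R -> I -> \bar R) (g : I -> \bar R) :
  (forall e i, (0 <= f e i)%E) -> (\esum_(i in [set: I]) g i < +oo)%E ->
  (\forall e \near F, forall i, (f e i <= g i)%E) ->
  (forall i (d : R), 0 < d -> \forall e \near F, (f e i <= d%:E)%E) ->
  forall d : R, 0 < d -> \forall e \near F, (\esum_(i in [set: I]) f e i <= d%:E)%E.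
Proof.
move=> f0 gfin fg f_cvg d d0.
have [[e0 fg0]|noe] := pselect (exists e, forall i, (f e i <= g i)%E); last first.
  by apply: filterS fg => e fge; exfalso; apply: noe; exists e.
have g0 i : (0 <= g i)%E by exact: le_trans (f0 e0 i) (fg0 i).
have gnum : (\esum_(i in [set: I]) g i)%E \is a fin_num.
  by rewrite ge0_fin_numE // esum_ge0.
have d2 : 0 < d / 2 by rewrite divr_gt0.
have [_ [J [finJ _] <-] gJ] := ub_ereal_sup_adherent d2 gnum.
have fsumE (h : I -> \bar R) : (forall i, (0 <= h i)%E) ->
    (\esum_(i in J) h i = \sum_(i <- fset_set J) h i)%E.
  by move=> h0; rewrite esum_fset // fsbig_finite.
have split_esum (h : I -> \bar R) : (forall i, (0 <= h i)%E) ->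
    (\esum_(i in [set: I]) h i = \esum_(i in J) h i + \esum_(i in ~` J) h i)%E.
  by move=> h0; rewrite (esumID J) // !setTI.
have gJ' : (\esum_(i in ~` J) g i <= (d / 2)%:E)%E.
  have gE := split_esum g g0.
  have gJfin : (\esum_(i in J) g i)%E \is a fin_num.
    by rewrite ge0_fin_numE ?esum_ge0 // (le_lt_trans _ gfin) // gE leeDl // esum_ge0.
  move: gJ; rewrite -esum_fset // lteBlDr // -/(esum _ _) => /ltW.
  by rewrite [X in (X <= _)%E]gE leeD2lE.
pose n := (size (fset_set J)).+1.
pose eta := d / 2 / n%:R.
have eta0 : 0 < eta by rewrite divr_gt0.
have nearJ : \forall e \near F, forall i, i \in fset_set J -> (f e i <= eta%:E)%E.
  have := @filter_bigI _ _ (fset_set J) (fun i => [set e | (f e i <= eta%:E)%E]) F FF.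
  move=> /(_ (fun i _ => f_cvg i _ eta0)); apply: filterS => e He i iJ.
  exact: (He i iJ).
apply: filterS2 nearJ fg => e feJ fge.
rewrite split_esum //.
rewrite (splitr d) EFinD leeD //; last first.
  by apply: le_trans gJ'; apply: le_esum.
rewrite fsumE //; apply: (@le_trans _ _ (\sum_(i <- fset_set J) eta%:E)%E).
  by rewrite !big_seq; apply: lee_sum => i; exact: feJ.
rewrite sumEFin big_const_seq count_predT iter_addr_0 lee_fin -[eta *+ _]mulr_natr /eta.
by rewrite mulrAC ler_pdivrMr // ler_wpM2l ?(ltW d2) // ler_nat.
Qed.

Lemma esum_scale_lty (R : realType) (I : choiceType) (c : R) (a : I -> \bar R) :
  0 <= c -> (forall i, (0 <= a i)%E) -> (\esum_(i in [set: I]) a i < +oo)%E ->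
  (\esum_(i in [set: I]) (c%:E * a i) < +oo)%E.
Proof.
move=> c0 a0 afin.
apply: (@le_lt_trans _ _ (c%:E * \esum_(i in [set: I]) a i)%E); last first.
  by rewrite lte_mul_pinfty.
apply: ge_ereal_sup => _ [X [finX _] <-].
rewrite -ge0_mule_fsumr //; apply: lee_wpmul2l; first by rewrite lee_fin.
by apply: ereal_sup_ubound; exists X.
Qed.

Lemma cvg_poweR_half (R : realType) (F : set_system R) (FF : Filter F) (f : R -> \bar R) :
  (forall e, (0 <= f e)%E) ->
  (forall d : R, 0 < d -> \forall e \near F, (f e <= d%:E)%E) ->
  (f e `^ 2^-1)%E @[e --> F] --> 0%E.
Proof.
move=> f0 fcvg.
have H d : 0 < d -> \forall e \near F, (f e `^ 2^-1 <= d%:E)%E.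
  move=> d0; have := fcvg (d ^+ 2); rewrite exprn_gt0 // => /(_ isT).
  apply: filterS => e fe.
  have -> : d%:E = ((d ^+ 2)%:E `^ 2^-1)%E.
    by rewrite poweR_EFin -powR_mulrn ?(ltW d0) // -powRrM mulfV // powRr1 // ltW.
  by rewrite gt0_ler_poweR ?in_itv /= ?f0 ?leey // ?invr_ge0 // lee_fin sqr_ge0.
apply: cvg_EFin.
  apply: filterS (H 1 ltr01) => e fe.
  by rewrite ge0_fin_numE ?poweR_ge0 // (le_lt_trans fe) // ltry.
apply/cvgrPdist_le => e e0; apply: filterS (H _ e0) => x fx.
rewrite sub0r normrN /= ger0_norm ?fine_ge0 ?poweR_ge0 //.
by rewrite -lee_fin fineK // ge0_fin_numE ?poweR_ge0 // (le_lt_trans fx) // ltry.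
Qed.

(** * Convergence of the very weak solution *)

Lemma abs_continuousB (R : realType) (E : normedModType R) (a b : R) (u v : R -> E) :
  abs_continuous a b u -> abs_continuous a b v -> abs_continuous a b (u \- v).
Proof.
move=> acu acv e e0.
have e2 : 0 < e / 2 by rewrite divr_gt0.
have [d1 d10 H1] := acu _ e2; have [d2 d20 H2] := acv _ e2.
exists (Num.min d1 d2); first by rewrite lt_min d10.
move=> n s t st ov; rewrite lt_min => /andP[l1 l2].
apply: (@le_lt_trans _ _ (\sum_i `|u (t i) - u (s i)| + \sum_i `|v (t i) - v (s i)|)).
  rewrite -big_split /=; apply: ler_sum => i _.
  by rewrite opprD addrACA -opprD ler_normB.
by rewrite (splitr e) ltrD ?H1 ?H2.
Qed.

Lemma domainB (R : realType) (E : normedModType R) (D : set E) (A : E -> E) x y :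
  densely_defined_closed D A -> D x -> D y -> D (x - y) /\ A (x - y) = A x - A y.
Proof.
move=> dA Dx Dy; have := domain_linear dA (-1) Dy Dx.
by rewrite !scaleN1r ![- _ + _]addrC.
Qed.

Lemma le_sup_norm (R : realType) (E : normedModType R) (T : R) (u : R -> E) (t : R) :
  0 <= t <= T -> (`|u t|%:E <= sup_norm T u)%E.
Proof. by move=> tT; apply: ereal_sup_ubound; exists t => //; rewrite /= in_itv. Qed.

Lemma sup_norm_le (R : realType) (E : normedModType R) (T : R) (u : R -> E) (c : R) :
  (forall t : R, 0 <= t <= T -> `|u t| <= c) -> (sup_norm T u <= c%:E)%E.
Proof.
move=> uc; apply: ge_ereal_sup => _ [t tT <-]; rewrite lee_fin; apply: uc.
by move: tT; rewrite /= in_itv.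
Qed.

Lemma sup_norm_ge0 (R : realType) (E : normedModType R) (T : R) (u : R -> E) :
  0 <= T -> (0 <= sup_norm T u)%E.
Proof.
move=> T0; apply: le_trans (le_sup_norm u (t := 0) _); first by rewrite lee_fin.
by rewrite lexx.
Qed.

Section difference_of_solutions.
Context (R : realType) (d : nat).
Local Notation H := (L2 R d).
Local Notation mu := (lebesgue_rV R d).
Variables (T : R) (D : set H) (A : H -> H) (S : R -> {linear H -> H}) (M : R).

(** [u - v] vanishes at [0] and solves the equation with potential [r] and source
    [- (r - q) v], of norm at most [delta]. *)
Lemma strong_solutionB_bound (q r : 'rV[R]_d -> R) (f u v : R -> H) (g : H) (Q delta : R) :
  densely_defined_closed D A -> C0_semigroup S -> generator S D A -> 1 <= M ->
  (forall (t : R) (x : H), 0 <= t <= T -> `|S t x| <= M * `|x|) ->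
  0 <= Q -> 0 <= delta -> ae_bounded mu q Q -> ae_bounded mu r Q ->
  strong_solution T D A (Lmul q) f g v -> strong_solution T D A (Lmul r) f g u ->
  (forall t : R, 0 <= t <= T -> `|Lmul (r \- q) (v t)| <= delta) ->
  forall t : R, 0 <= t <= T ->
    `|u t - v t| <= 2 * M * T * expR ((2 * M * Q + 1) * T) * delta.
Proof.
move=> dA S_C0 S_gen M1 S_le Q0 d0 qQ rQ.
move=> [[cv Dv] acv v0 [v' _ aev]] [[cu Du] acu u0 [u' _ aeu]] rqv.
apply: (@gronwall_bound _ _ S D A T M (u \- v) Q delta) => //.
- exact: within_continuousB.
- by rewrite /= u0 v0 subrr.
- exact: abs_continuousB.
- move=> s sT; have sT' : s \in `[0, T] by rewrite in_itv.
  by have [] := domainB dA (Du _ sT') (Dv _ sT').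
apply: negligibleS (negligibleU aev aeu) => s /= nH.
apply: contrapT => /not_orP[/contrapT hv /contrapT hu]; apply: nH => sT.
have [dv ve] := hv sT; have [du ue] := hu sT.
have sT0 : 0 <= s <= T by move: sT; rewrite in_itv /= => /andP[/ltW -> /ltW ->].
have sT' : s \in `[0, T] by rewrite in_itv.
exists (u' s - v' s); first exact: is_deriveB.
have [_ ->] := domainB dA (Du _ sT') (Dv _ sT').
have -> : u' s - v' s - (A (u s) - A (v s)) =
    - (Lmul r (u s - v s) + Lmul (r \- q) (v s)).
  rewrite (LmulB _ _ rQ) (Lmul_subl _ rQ qQ) subrKA.
  have -> : u' s = f s - Lmul r (u s) + A (u s) by rewrite -ue addrK subrK.
  have -> : v' s = f s - Lmul q (v s) + A (v s) by rewrite -ve addrK subrK.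
  by rewrite (opprD (f s - _)) addrACA addrK !opprB [LHS]addrC subrKA.
rewrite normrN (le_trans (ler_normD _ _)) // lerD ?rqv //.
exact: Lmul_le.
Qed.
End difference_of_solutions.

Theorem theorem11 (R : realType) (d : nat) (T : R)
    (D : set (L2 R d)) (A : L2 R d -> L2 R d)
    (F : chaos (R -> L2 R d)) (G : chaos (L2 R d))
    (q : 'rV[R]_d -> R)
    (phi : 'rV[R]_d -> R) (l : R -> R)
    (V : chaos (R -> L2 R d)) (U : R -> chaos (R -> L2 R d)) :
  (0 < d)%N -> 0 < T ->
  densely_defined_closed D A ->
  (exists S : R -> {linear L2 R d -> L2 R d},
      C0_semigroup S /\ generator S D A) ->
  process T F ->
  (forall gamma, [lipschitz F gamma t | t in `[0, T]]) ->
  initial_datum D G ->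
  q \in Lfun (lebesgue_rV R d) +oo -> continuous q ->
  mollifier phi ->
  (forall eps, 0 < eps <= 1 -> 0 < l eps) -> l eps @[eps --> 0^'+] --> 0 ->
  solution T D A q F G V ->
  very_weak_solution T D A (regularizing_net q phi l) F G U ->
  exists2 s : R, 1 < s &
    chaos_norm (sup_norm T) s (fun gamma => U eps gamma \- V gamma)
      @[eps --> 0^'+] --> 0%E.
Proof.
move=> _ T0 dA [S [S_C0 S_gen]] _ _ _ qL cq mol l0 lcvg.
move=> [[p p0 [Vin Vfin]] solV] [[N [C [C0 modq]]] _ solU _].
pose mu := lebesgue_rV R d.
have [M M1 S_le] := L2_semigroup_bound T S_C0.
have [mq [Q Q0 qQ]] := Lfun_infty_ae_bounded qL.
have bq : ae_bounded mu q Q by [].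
have bqe eps : 0 < eps <= 1 -> ae_bounded mu (regularizing_net q phi l eps) Q.
  move=> eps01; split; first by have [/Lfun_infty_ae_bounded[]] := modq _ eps01.
  by apply: aeW => x; apply: regularizing_net_le => //; exact: l0.
pose r eps := regularizing_net q phi l eps \- q.
have br eps : 0 < eps <= 1 -> ae_bounded mu (r eps) (Q + Q).
  by move=> eps01; apply: ae_boundedB => //; exact: bqe.
have rcvg x : r eps x @[eps --> 0^'+] --> 0.
  have := cvgB (regularizing_net_cvg mq mol (cq x) l0 lcvg) (@cvg_cst _ (q x) _ _ _).
  by rewrite subrr; exact.
pose Cst := 2 * M * T * expR ((2 * M * Q + 1) * T).
have Cst0 : 0 <= Cst.
  by rewrite /Cst !mulr_ge0 ?expR_ge0 ?(ltW T0) // (le_trans ler01).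
have key eps gamma delta : 0 < eps <= 1 -> 0 <= delta ->
    (forall t : R, 0 <= t <= T -> `|Lmul (r eps) (V gamma t)| <= delta) ->
    (sup_norm T (U eps gamma \- V gamma)%R <= (Cst * delta)%:E)%E.
  move=> eps01 delta0 rV; apply: sup_norm_le => t tT.
  by apply: (strong_solutionB_bound dA S_C0 S_gen M1 S_le Q0 delta0 bq
    (bqe _ eps01) (solV gamma) ((solU _ eps01).2 gamma)).
(* The weights for exponent [p] make [V] summable; adding [2] only serves to
   exceed [1]. *)
exists (p + 2); first by rewrite ltr_wpDl // ltr1n.
have w0 gamma s : (0 <= (weight R gamma `^ s)%:E)%E by rewrite lee_fin powR_ge0.
have sup0 u : (0 <= sup_norm T u :> \bar R)%E by apply: sup_norm_ge0; exact: ltW.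
have square (x y : \bar R) : (0 <= x -> x <= y -> x * x <= y * y)%E.
  by move=> x0 xy; apply: lee_pmul.
have {}Vfin : (\esum_(gamma in [set: multi_index])
    (sup_norm T (V gamma) ^+ 2 * (weight R gamma `^ (- p))%:E) < +oo)%E.
  by apply: (lty_poweRy _ Vfin); rewrite invr_eq0.
pose C' := Cst * (Q + Q) + 1.
have C'0 : 0 < C' by rewrite ltr_wpDl // mulr_ge0 // addr_ge0.
(* The terms are only controlled for [eps] in [(0, 1]]; the value [0] elsewhere
   does not affect the limit. *)
pose f eps gamma : \bar R := if 0 < eps <= 1 then
  (sup_norm T (U eps gamma \- V gamma)%R ^+ 2 * (weight R gamma `^ (- (p + 2)))%:E)%E
  else 0%E.
pose g gamma : \bar R := ((C' ^+ 2)%:E *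
  (sup_norm T (V gamma) ^+ 2 * (weight R gamma `^ (- p))%:E))%E.
have near01 : \forall eps \near (0 : R)^'+, 0 < eps <= 1.
  by near=> eps; apply/andP; split; near: eps; [exact: nbhs_right_gt|exact: nbhs_right_le].
have f0 eps gamma : (0 <= f eps gamma)%E.
  by rewrite /f; case: ifP => // _; rewrite mule_ge0 // expe_ge0.
have gfin : (\esum_(gamma in [set: multi_index]) g gamma < +oo)%E.
  apply: esum_scale_lty => // [|gamma]; first exact: sqr_ge0.
  by rewrite mule_ge0 // expe_ge0.
have fg : \forall eps \near (0 : R)^'+, forall gamma, (f eps gamma <= g gamma)%E.
  apply: filterS near01 => eps eps01 gamma; rewrite /f eps01 /g muleA.
  apply: lee_pmul => //; first by rewrite expe_ge0.
    rewrite EFin_expe !expe2 -muleACA; apply: square => //.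
    have [Voo|Voo] := eqVneq (sup_norm T (V gamma)) +oo%E.
      by rewrite Voo gt0_muley ?lte_fin // leey.
    have Vf : sup_norm T (V gamma) \is a fin_num by rewrite ge0_fin_numE // ltey.
    have VB (t : R) : 0 <= t <= T -> `|V gamma t| <= fine (sup_norm T (V gamma)).
      by move=> tT; rewrite -lee_fin (fineK Vf); exact: le_sup_norm.
    rewrite -(fineK Vf) -EFinM.
    have B0 : 0 <= fine (sup_norm T (V gamma)) by rewrite fine_ge0.
    apply: le_trans (key eps gamma ((Q + Q) * fine (sup_norm T (V gamma))) eps01 _ _) _.
    - by rewrite mulr_ge0 // addr_ge0.
    - move=> t tT; apply: le_trans (Lmul_le _ _ (br _ eps01)) _; first by rewrite addr_ge0.
      by rewrite ler_wpM2l ?addr_ge0 // VB.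
    by rewrite lee_fin mulrA /C' mulrDl lerDl mul1r.
  by rewrite lee_fin ler_powR ?weight_ge1 // lerN2 lerDl.
have fcvg gamma (e : R) : 0 < e -> \forall eps \near (0 : R)^'+, (f eps gamma <= e%:E)%E.
  move=> e0; pose delta := Num.sqrt e / (Cst + 1).
  have C1 : 0 < Cst + 1 by rewrite ltr_wpDl.
  have delta0 : 0 < delta by rewrite divr_gt0 // sqrtr_gt0.
  have Cd0 : 0 <= Cst * delta by rewrite mulr_ge0 // ltW.
  have [[cV _] _ _ _] := solV gamma.
  have QQ0 : 0 <= Q + Q by rewrite addr_ge0.
  apply: filterS2 near01 (Lmul_cvg0_uniform QQ0 delta0 cV br rcvg) => eps eps01 rV.
  rewrite /f eps01.
  have := key eps gamma delta eps01 (ltW delta0) rV.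
  move=> supC; rewrite -[e%:E]mule1; apply: lee_pmul => //; first by rewrite expe_ge0.
    apply: (@le_trans _ _ ((Cst * delta)%:E ^+ 2)%E); first by rewrite !expe2; exact: square.
    rewrite -EFin_expe lee_fin -[leRHS](sqr_sqrtr (ltW e0)).
    rewrite ler_pXn2r ?nnegrE ?sqrtr_ge0 //.
    by rewrite /delta mulrCA ler_piMr ?sqrtr_ge0 // ler_pdivrMr // mul1r lerDl.
  rewrite lee_fin -[leRHS](powRr0 (weight R gamma)); apply: ler_powR; first exact: weight_ge1.
  by rewrite oppr_le0 addr_ge0.
have H : ((\esum_(gamma in [set: multi_index]) f eps gamma) `^ 2^-1)%E
    @[eps --> 0^'+] --> 0%E.
  apply: cvg_poweR_half; first by move=> eps; exact: esum_ge0.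
  exact: (esum_dominated_cvg0 _ f0 gfin fg fcvg).
apply: cvg_trans H; apply: near_eq_cvg; apply: filterS near01 => eps eps01.
by rewrite /chaos_norm; congr (_ `^ _)%E; apply: eq_esum => gamma _; rewrite /f eps01.
Unshelve. all: by end_near. Qed.
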